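(* Let $m\ge 1$ be an integer, let $\mathfrak{M}$ be a crossed $m$-cube of groups, and let $\mathcal{X}(\mathfrak{M})$ be its $m$-fold nerve, which is an $m$-simplicial group. Then the Moore complex of the $m$-fold codiagonal $\nabla^{(m)}\mathcal{X}(\mathfrak{M})$ satisfies $$N\big(\nabla^{(m)}\mathcal{X}(\mathfrak{M})\big)_n=1\quad\text{for all } n\geq m+1 .$$
   Context: Moore complex: for a simplicial group $G$, $N(G)_n=\bigcap_{i=0}^{n-1}\ker(d_i:G_n\to G_{n-1})$ (with $N(G)_0=G_0$); $1$ denotes the trivial group. Crossed $m$-cube of groups: write $\langle m\rangle=\{1,\ldots,m\}$. It is a family of groups $\{\mathfrak{M}_A:A\subseteq\langle m\rangle\}$ with homomorphisms $\mu_i:\mathfrak{M}_A\to\mathfrak{M}_{A\setminus\{i\}}$ ($i\in\langle m\rangle$) and functions $h:\mathfrak{M}_A\times\mathfrak{M}_B\to\mathfrak{M}_{A\cup B}$ ($A,B\subseteq\langle m\rangle$) such that, writing ${}^ab=h(a,b)b$ for $a\in\mathfrak{M}_A$, $b\in\mathfrak{M}_B$ with $A\subseteq B$, for all $a,a'\in\mathfrak{M}_A$, $b,b'\in\mathfrak{M}_B$, $c\in\mathfrak{M}_C$ and $i,j\in\langle m\rangle$: (1) $\mu_ia=a$ if $i\notin A$; (2) $\mu_i\mu_ja=\mu_j\mu_ia$; (3) $\mu_ih(a,b)=h(\mu_ia,\mu_ib)$; (4) $h(a,b)=h(\mu_ia,b)=h(a,\mu_ib)$ if $i\in A\cap B$;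 (5) $h(a,a')=[a,a']=aa'a^{-1}a'^{-1}$; (6) $h(a,b)=h(b,a)^{-1}$; (7) $h(a,b)=1$ if $a=1$ or $b=1$; (8) $h(aa',b)={}^ah(a',b)\,h(a,b)$; (9) $h(a,bb')=h(a,b)\,{}^bh(a,b')$; (10) ${}^ah(b,c)=h({}^ab,{}^ac)$ if $A\subseteq B\cap C$; (11) ${}^ah(h(a^{-1},b),c)\;{}^ch(h(c^{-1},a),b)\;{}^bh(h(b^{-1},c),a)=1$. Morphisms are families of homomorphisms commuting with all $\mu_i$ and $h$. Cat$^m$-groups: a cat$^1$-group is a group $G$ with endomorphisms $s,t$ satisfying $st=t$, $ts=s$ and $[\ker s,\ker t]=1$. A cat$^m$-group is a group $G$ with $m$ cat$^1$-group structures $(s_i,t_i)$, $1\le i\le m$, satisfying $s_is_j=s_js_i$, $t_it_j=t_jt_i$, $s_it_j=t_js_i$ for $i\ne j$. To a cat$^m$-group is associated the crossed $m$-cube with $\mathfrak{M}_A=\bigcap_{i\in A}\ker s_i\cap\bigcap_{i\notin A}\operatorname{Im}s_i$, $\mu_i$ the restriction of $t_i$, and $h(a,b)=[a,b]$ computed in $G$. By a known theorem (Loday for $m=1,2$; Ellis–Steiner in general) this is an equivalence of categories between cat$^m$-groups and crossed $m$-cubes; in particular every crossed $m$-cube is isomorphic to the one associated to a cat$^m$-group, unique up to isomorphism. Nerve: a cat$^1$-group $(G,s,t)$ is an internal groupoid in groups, with group of objects $\operatorname{Im}s=\operatorname{Im}t$, group of arrows $G$ (an element $g$ is an arrow from $s(g)$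 to $t(g)$), and composite of $g$ followed by $g'$ (where $t(g)=s(g')$) equal to $g'\,s(g')^{-1}g$. Its nerve is the simplicial group whose group of $0$-simplices is $\operatorname{Im}s$ and whose $n$-simplices ($n\ge1$) are the composable strings $(g_1,\ldots,g_n)\in G^n$, $t(g_i)=s(g_{i+1})$, with the usual nerve operators ($d_0$ omits the first arrow, so that $d_0=t$ and $d_1=s$ on $1$-simplices). $m$-fold nerve: an $m$-simplicial group is a functor $(\Delta^{\times m})^{op}\to$ Groups. The $m$-fold nerve $\mathcal{X}(\mathfrak{M})$ is obtained from the cat$^m$-group corresponding to $\mathfrak{M}$ by applying the nerve construction in each of the $m$ directions in turn (applying the nerve to one cat$^1$-structure of a cat$^m$-group gives a simplicial object in cat$^{m-1}$-groups, and one repeats). It is well defined up to isomorphism. Codiagonal: for a bisimplicial group $\mathcal{Y}_{p,q}$ with horizontal operators $d_i^h,s_i^h$ (on the index $p$) and vertical operators $d_j^v,s_j^v$ (on the index $q$), the simplicial group $\nabla\mathcal{Y}$ is $$(\nabla\mathcal{Y})_n=\Big\{(x_0,\ldots,x_n)\in\prod_{p=0}^n\mathcal{Y}_{p,n-p}: d_0^vx_p=d_{p+1}^hx_{p+1},\ 0\le p\le n-1\Big\},$$ with $d_j(x_0,\ldots,x_n)=(d_j^vx_0,d_{j-1}^vx_1,\ldots,d_1^vx_{j-1},d_j^hx_{j+1},\ldots,d_j^hx_n)$ for $0<j<n$, $d_0(x_0,\ldots,x_n)=(d_0^hx_1,\ldots,d_0^hx_n)$, $d_n(x_0,\ldots,x_n)=(d_n^vx_0,\ldots,d_1^vx_{n-1})$,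 and $s_i(x_0,\ldots,x_n)=(s_i^vx_0,s_{i-1}^vx_1,\ldots,s_0^vx_i,s_i^hx_i,\ldots,s_i^hx_n)$ for $0\le i\le n$. $m$-fold codiagonal: $\nabla^{(1)}$ is the identity, $\nabla^{(2)}=\nabla$, and for an $m$-simplicial group $\mathcal{X}$ with $m\ge2$, $\nabla^{(m)}\mathcal{X}=\nabla(\nabla^{(m-1)}\mathcal{X}_{\underline{*},?})$: for each fixed value of the last index $?$ apply $\nabla^{(m-1)}$ to the first $m-1$ indices, obtaining a bisimplicial group (first index from $\nabla^{(m-1)}$, second index $?$), and then apply $\nabla$. *)

(* Defs.v *)
From HB Require Import structures.
From mathcomp Require Import all_boot zify.
From mathcomp Require Import boolp.

Set Implicit Arguments.
Unset Strict Implicit.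
Unset Printing Implicit Defensive.

Local Open Scope group_scope.

Notation ghom G H := (UMagmaMorphism.type G H).

Lemma ghomP (G H : groupType) (f g : ghom G H) : f =1 g -> f = g.
Proof.
case: f => f [[f1] [f2]]; case: g => g [[g1] [g2]] /= /funext e.
by subst g; rewrite (Prop_irrelevance f1 g1) (Prop_irrelevance f2 g2).
Qed.

Section MkGhom.
Variables (G H : groupType) (f : G -> H) (fM : {morph f : x y / x * y}).
Definition mk_ghom_fun : G -> H := let _ := fM in f.
Fact mk_ghom_subproof : {morph mk_ghom_fun : x y / x / y}.
Proof.
have f1 : f 1 = 1 by apply: (mulgI (f 1)); rewrite -fM !mulg1.
have fV y : f y^-1 = (f y)^-1 by apply: (mulgI (f y)); rewrite -fM !mulgV.
by move=> x y; rewrite /mk_ghom_fun fM fV.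
Qed.
HB.instance Definition _ :=
  isGroupMorphism.Build G H mk_ghom_fun mk_ghom_subproof.
Definition mk_ghom : ghom G H := mk_ghom_fun.
End MkGhom.

Definition trivial_group (G : groupType) : Prop := forall x : G, x = 1.

Record subgroup (G : groupType) := Subgroup {
  sg_mem :> G -> Prop;
  sg_mem1 : sg_mem 1;
  sg_memM : forall x y, sg_mem x -> sg_mem y -> sg_mem (x * y);
  sg_memV : forall x, sg_mem x -> sg_mem x^-1
}.

Section SubgroupType.
Variables (G : groupType) (P : subgroup G).

Record sg_type := SgElt { sgval : G; sgvalP : P sgval }.

Lemma sgval_inj : injective sgval.
Proof.
case=> x Px [y Py] /= e; subst y; congr SgElt; exact: Prop_irrelevance.
Qed.

Definition sg_one := SgElt (sg_mem1 P).
Definition sg_inv (x : sg_type) := SgElt (sg_memV (sgvalP x)).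
Definition sg_mul (x y : sg_type) := SgElt (sg_memM (sgvalP x) (sgvalP y)).

Fact sg_mulA : associative sg_mul.
Proof. by move=> x y z; apply: sgval_inj; rewrite /= mulgA. Qed.
Fact sg_mul1g : left_id sg_one sg_mul.
Proof. by move=> x; apply: sgval_inj; rewrite /= mul1g. Qed.
Fact sg_mulg1 : right_id sg_one sg_mul.
Proof. by move=> x; apply: sgval_inj; rewrite /= mulg1. Qed.
Fact sg_mulVg : left_inverse sg_one sg_inv sg_mul.
Proof. by move=> x; apply: sgval_inj; rewrite /= mulVg. Qed.
Fact sg_mulgV : right_inverse sg_one sg_inv sg_mul.
Proof. by move=> x; apply: sgval_inj; rewrite /= mulgV. Qed.

HB.instance Definition _ := gen_eqMixin sg_type.
HB.instance Definition _ := gen_choiceMixin sg_type.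
HB.instance Definition _ := isGroup.Build sg_type
  sg_mulA sg_mul1g sg_mulg1 sg_mulVg sg_mulgV.
End SubgroupType.

Coercion subgroup_group (G : groupType) (P : subgroup G) : groupType :=
  sg_type P.

Record category := Category {
  ob :> Type;
  hom : ob -> ob -> Type;
  idm : forall a, hom a a;
  cmp : forall a b c, hom b c -> hom a b -> hom a c;
  cmp1m : forall a b (f : hom a b), cmp (idm b) f = f;
  cmpm1 : forall a b (f : hom a b), cmp f (idm a) = f;
  cmpA : forall a b c d (h : hom c d) (g : hom b c) (f : hom a b),
    cmp h (cmp g f) = cmp (cmp h g) f
}.
Arguments idm {c} a : rename.
Notation "g \oc f" := (cmp g f) (at level 50, left associativity).

Definition isomorphic (C : category) (a b : C) : Prop :=
  exists (f : hom a b) (g : hom b a), g \oc f = idm a /\ f \oc g = idm b.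

Record functor (C D : category) := Functor {
  fob :> C -> D;
  fmap : forall a b : C, hom a b -> hom (fob a) (fob b);
  fmap1 : forall a : C, fmap (idm a) = idm (fob a);
  fmapM : forall (a b c : C) (g : hom b c) (f : hom a b),
    fmap (g \oc f) = fmap g \oc fmap f
}.
Arguments fmap {C D} f {a b} _ : rename.

Definition functor_id (C : category) : functor C C :=
  @Functor C C (fun a => a) (fun a b f => f) (fun a => erefl)
    (fun a b c g f => erefl).

Section FunctorComp.
Variables (C D E : category) (F : functor D E) (G : functor C D).
Fact functor_comp_1 (a : C) : fmap F (fmap G (idm a)) = idm (F (G a)).
Proof. by rewrite !fmap1. Qed.
Fact functor_comp_M (a b c : C) (g : hom b c) (f : hom a b) :
  fmap F (fmap G (g \oc f)) = fmap F (fmap G g) \oc fmap F (fmap G f).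
Proof. by rewrite !fmapM. Qed.
Definition functor_comp : functor C E :=
  @Functor C E (fun a => F (G a)) (fun a b f => fmap F (fmap G f))
    functor_comp_1 functor_comp_M.
End FunctorComp.

Section GroupCategory.
Definition gcomp (G H K : groupType) (g : ghom H K) (f : ghom G H) : ghom G K :=
  g \o f.
Definition gid (G : groupType) : ghom G G := idfun.
Fact gcmp1m (G H : groupType) (f : ghom G H) : gcomp (gid H) f = f.
Proof. exact: ghomP. Qed.
Fact gcmpm1 (G H : groupType) (f : ghom G H) : gcomp f (gid G) = f.
Proof. exact: ghomP. Qed.
Fact gcmpA (G H K L : groupType) (h : ghom K L) (g : ghom H K) (f : ghom G H) :
  gcomp h (gcomp g f) = gcomp (gcomp h g) f.
Proof. exact: ghomP. Qed.
Definition GrpC : category :=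
  @Category groupType (fun G H => ghom G H) gid gcomp gcmp1m gcmpm1 gcmpA.
End GroupCategory.

(* Simplicial objects are presented by the face and degeneracy operators.
   Indices of face and degeneracy operators are ordinals, but all formulas are
   written with natural numbers [k] in range, turned into ordinals by
   [inord]. *)
Record sobject (C : category) := SObject {
  sob :> nat -> C;
  sface : forall n, 'I_n.+2 -> hom (sob n.+1) (sob n);
  sdegen : forall n, 'I_n.+1 -> hom (sob n) (sob n.+1);
  sface_face : forall n i j, i < j -> j <= n.+2 ->
    @sface n (inord i) \oc @sface n.+1 (inord j) =
    @sface n (inord j.-1) \oc @sface n.+1 (inord i);
  sface_degen_lt : forall n i j, i < j -> j <= n.+1 ->
    @sface n.+1 (inord i) \oc @sdegen n.+1 (inord j) =
    @sdegen n (inord j.-1) \oc @sface n (inord i);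
  sface_degen_eq : forall n i j, j <= n -> (i == j) || (i == j.+1) ->
    @sface n (inord i) \oc @sdegen n (inord j) = idm (sob n);
  sface_degen_gt : forall n i j, j.+1 < i -> i <= n.+2 ->
    @sface n.+1 (inord i) \oc @sdegen n.+1 (inord j) =
    @sdegen n (inord j) \oc @sface n (inord i.-1);
  sdegen_degen : forall n i j, i <= j -> j <= n ->
    @sdegen n.+1 (inord i) \oc @sdegen n (inord j) =
    @sdegen n.+1 (inord j.+1) \oc @sdegen n (inord i)
}.
Arguments sface {C} s {n} i.
Arguments sdegen {C} s {n} i.

Record smor (C : category) (X Y : sobject C) := SMor {
  smc :> forall n, hom (X n) (Y n);
  smc_face : forall n (i : 'I_n.+2),
    smc n \oc sface X i = sface Y i \oc smc n.+1;
  smc_degen : forall n (i : 'I_n.+1),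
    smc n.+1 \oc sdegen X i = sdegen Y i \oc smc n
}.

Lemma smorP (C : category) (X Y : sobject C) (f g : smor X Y) :
  (forall n, f n = g n) -> f = g.
Proof.
case: f => f f1 f2; case: g => g g1 g2 /= fg.
have e := functional_extensionality_dep fg.
by subst g; rewrite (Prop_irrelevance f1 g1) (Prop_irrelevance f2 g2).
Qed.

Section SimplicialCategory.
Variable C : category.

Definition smor_id (X : sobject C) : smor X X.
Proof.
by exists (fun n => idm (X n)) => n i; rewrite cmpm1 cmp1m.
Defined.

Definition smor_comp (X Y Z : sobject C) (g : smor Y Z) (f : smor X Y) :
  smor X Z.
Proof.
exists (fun n => g n \oc f n) => n i.
- by rewrite -cmpA smc_face !cmpA smc_face.
- by rewrite -cmpA smc_degen !cmpA smc_degen.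
Defined.

Fact scmp1m (X Y : sobject C) (f : smor X Y) : smor_comp (smor_id Y) f = f.
Proof. by apply: smorP => n; apply: cmp1m. Qed.
Fact scmpm1 (X Y : sobject C) (f : smor X Y) : smor_comp f (smor_id X) = f.
Proof. by apply: smorP => n; apply: cmpm1. Qed.
Fact scmpA (X Y Z T : sobject C) (h : smor Z T) (g : smor Y Z) (f : smor X Y) :
  smor_comp h (smor_comp g f) = smor_comp (smor_comp h g) f.
Proof. by apply: smorP => n; apply: cmpA. Qed.

Definition simpC : category := Category scmp1m scmpm1 scmpA.
End SimplicialCategory.

Section SimplicialFunctor.
Variables (C D : category) (F : functor C D).

Definition sobject_map (X : sobject C) : sobject D.
Proof.
exists (fun n => F (X n)) (fun n i => fmap F (sface X i))
  (fun n i => fmap F (sdegen X i)) => n i j; rewrite -!fmapM.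
- by move=> ij jn; rewrite sface_face.
- by move=> ij jn; rewrite sface_degen_lt.
- by move=> jn e; rewrite sface_degen_eq // fmap1.
- by move=> ji iN; rewrite sface_degen_gt.
- by move=> ij jn; rewrite sdegen_degen.
Defined.

Definition smor_map (X Y : sobject C) (f : smor X Y) :
  smor (sobject_map X) (sobject_map Y).
Proof.
exists (fun n => fmap F (f n)) => n i /=; rewrite -!fmapM.
- by rewrite smc_face.
- by rewrite smc_degen.
Defined.

Fact smor_map1 (X : simpC C) : smor_map (idm X) = idm (sobject_map X : simpC D).
Proof. by apply: smorP => n; apply: fmap1. Qed.
Fact smor_mapM (X Y Z : simpC C) (g : hom Y Z) (f : hom X Y) :
  smor_map (g \oc f) = (smor_map g : hom (sobject_map Y : simpC D) _) \oc smor_map f.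
Proof. by apply: smorP => n; apply: fmapM. Qed.

Definition simpF : functor (simpC C) (simpC D) :=
  @Functor (simpC C) (simpC D) sobject_map smor_map smor_map1 smor_mapM.
End SimplicialFunctor.

(* An m-simplicial group X_{p_1,...,p_m} is encoded by currying: an
   m.+1-simplicial group is a simplicial object, indexed by the last index
   p_{m+1}, in the category of m-simplicial groups. *)
Fixpoint msimpC (m : nat) : category :=
  if m is m'.+1 then simpC (msimpC m') else GrpC.

Section SimplicialGroup.
Variable X : simpC GrpC.

Definition face {n} (i : nat) : ghom (X n.+1) (X n) := sface X (inord i).
Definition degen {n} (i : nat) : ghom (X n) (X n.+1) := sdegen X (inord i).

Lemma face_face n i j (x : X n.+2) : i < j -> j <= n.+2 ->
  face i (face j x) = face j.-1 (face i x).
Proof.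
by move=> ij jn; have /(congr1 (fun f : ghom _ _ => f x)) := sface_face X ij jn.
Qed.
Lemma face_degen_lt n i j (x : X n.+1) : i < j -> j <= n.+1 ->
  face i (degen j x) = degen j.-1 (face i x).
Proof.
move=> ij jn.
by have /(congr1 (fun f : ghom _ _ => f x)) := sface_degen_lt X ij jn.
Qed.
Lemma face_degen_eq n i j (x : X n) : j <= n -> (i == j) || (i == j.+1) ->
  face i (degen j x) = x.
Proof.
move=> jn ij.
by have /(congr1 (fun f : ghom _ _ => f x)) := sface_degen_eq X jn ij.
Qed.
Lemma face_degen_gt n i j (x : X n.+1) : j.+1 < i -> i <= n.+2 ->
  face i (degen j x) = degen j (face i.-1 x).
Proof.
move=> ij iN.
by have /(congr1 (fun f : ghom _ _ => f x)) := sface_degen_gt X ij iN.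
Qed.
Lemma degen_degen n i j (x : X n) : i <= j -> j <= n ->
  degen i (degen j x) = degen j.+1 (degen i x).
Proof.
move=> ij jn.
by have /(congr1 (fun f : ghom _ _ => f x)) := sdegen_degen X ij jn.
Qed.

Definition moore_mem n : X n -> Prop :=
  if n is n'.+1 then fun x => forall i, i <= n' -> face i x = 1
  else fun _ => True.

Definition moore n : subgroup (X n).
Proof.
exists (@moore_mem n); case: n => [|n] //=.
- by move=> i _; rewrite gmulf1.
- by move=> x y Hx Hy i iN; rewrite gmulfM Hx // Hy // mulg1.
- by move=> x Hx i iN; rewrite gmulfV Hx // invg1.
Defined.
End SimplicialGroup.
Arguments face {X n} i.
Arguments degen {X n} i.

(* A bisimplicial group Y_{p,q} is an object of [simpC (simpC GrpC)] whose
   outer index is q; thus Y_{p,q} is [Y q p], the horizontal operators (on p)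
   are those of the simplicial group [Y q], and the vertical operators (on q)
   are the components of those of Y.
   An element (x_0,...,x_n) of the codiagonal is written as the family
   x_p = x p q with q = n - p. *)
Section Codiagonal.
Variable Y : simpC (simpC GrpC).

Definition smor_at (A B : simpC GrpC) (f : hom A B) p : ghom (A p) (B p) :=
  (f : smor A B) p.

Definition face_h {p q} (i : nat) : ghom (Y q p.+1) (Y q p) := face i.
Definition degen_h {p q} (i : nat) : ghom (Y q p) (Y q p.+1) := degen i.
Definition face_v {p q} (j : nat) : ghom (Y q.+1 p) (Y q p) :=
  smor_at (sface Y (inord j)) p.
Definition degen_v {p q} (j : nat) : ghom (Y q p) (Y q.+1 p) :=
  smor_at (sdegen Y (inord j)) p.

Lemma face_vv p q i j (x : Y q.+2 p) : i < j -> j <= q.+2 ->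
  face_v i (face_v j x) = face_v j.-1 (face_v i x).
Proof.
move=> ij jn.
by have /(congr1 (fun f : hom (Y (q.+2)) (Y (q)) => smor_at f p x)) :=
  sface_face Y ij jn.
Qed.
Lemma face_degen_v_lt p q i j (x : Y q.+1 p) : i < j -> j <= q.+1 ->
  face_v i (degen_v j x) = degen_v j.-1 (face_v i x).
Proof.
move=> ij jn.
by have /(congr1 (fun f : hom (Y (q.+1)) (Y (q.+1)) => smor_at f p x)) :=
  sface_degen_lt Y ij jn.
Qed.
Lemma face_degen_v_eq p q i j (x : Y q p) : j <= q -> (i == j) || (i == j.+1) ->
  face_v i (degen_v j x) = x.
Proof.
move=> jn ij.
by have /(congr1 (fun f : hom (Y (q)) (Y (q)) => smor_at f p x)) :=
  sface_degen_eq Y jn ij.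
Qed.
Lemma face_degen_v_gt p q i j (x : Y q.+1 p) : j.+1 < i -> i <= q.+2 ->
  face_v i (degen_v j x) = degen_v j (face_v i.-1 x).
Proof.
move=> ij iN.
by have /(congr1 (fun f : hom (Y (q.+1)) (Y (q.+1)) => smor_at f p x)) :=
  sface_degen_gt Y ij iN.
Qed.
Lemma degen_vv p q i j (x : Y q p) : i <= j -> j <= q ->
  degen_v i (degen_v j x) = degen_v j.+1 (degen_v i x).
Proof.
move=> ij jn.
by have /(congr1 (fun f : hom (Y (q)) (Y (q.+2)) => smor_at f p x)) :=
  sdegen_degen Y ij jn.
Qed.

Lemma face_vh p q i j (x : Y q.+1 p.+1) :
  face_v j (face_h i x) = face_h i (face_v j x).
Proof.
by have /(congr1 (fun f : ghom _ _ => f x)) :=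
  smc_face (sface Y (inord j) : smor (Y q.+1) (Y q)) (inord i : 'I_p.+2).
Qed.
Lemma face_v_degen_h p q i j (x : Y q.+1 p) :
  face_v j (degen_h i x) = degen_h i (face_v j x).
Proof.
by have /(congr1 (fun f : ghom _ _ => f x)) :=
  smc_degen (sface Y (inord j) : smor (Y q.+1) (Y q)) (inord i : 'I_p.+1).
Qed.
Lemma degen_v_face_h p q i j (x : Y q p.+1) :
  degen_v j (face_h i x) = face_h i (degen_v j x).
Proof.
by have /(congr1 (fun f : ghom _ _ => f x)) :=
  smc_face (sdegen Y (inord j) : smor (Y q) (Y q.+1)) (inord i : 'I_p.+2).
Qed.
Lemma degen_vh p q i j (x : Y q p) :
  degen_v j (degen_h i x) = degen_h i (degen_v j x).
Proof.
by have /(congr1 (fun f : ghom _ _ => f x)) :=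
  smc_degen (sdegen Y (inord j) : smor (Y q) (Y q.+1)) (inord i : 'I_p.+1).
Qed.

Lemma face_hh p q i j (x : Y q p.+2) : i < j -> j <= p.+2 ->
  face_h i (face_h j x) = face_h j.-1 (face_h i x).
Proof. exact: face_face. Qed.
Lemma face_degen_h_lt p q i j (x : Y q p.+1) : i < j -> j <= p.+1 ->
  face_h i (degen_h j x) = degen_h j.-1 (face_h i x).
Proof. exact: face_degen_lt. Qed.
Lemma face_degen_h_eq p q i j (x : Y q p) : j <= p -> (i == j) || (i == j.+1) ->
  face_h i (degen_h j x) = x.
Proof. exact: face_degen_eq. Qed.
Lemma face_degen_h_gt p q i j (x : Y q p.+1) : j.+1 < i -> i <= p.+2 ->
  face_h i (degen_h j x) = degen_h j (face_h i.-1 x).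
Proof. exact: face_degen_gt. Qed.
Lemma degen_hh p q i j (x : Y q p) : i <= j -> j <= p ->
  degen_h i (degen_h j x) = degen_h j.+1 (degen_h i x).
Proof. exact: degen_degen. Qed.

Record codiag_type (n : nat) := CodiagElt {
  codiag_val :> forall p q, p + q = n -> Y q p;
  codiag_valP : forall p q (e : p + q.+1 = n) (e' : p.+1 + q = n),
    face_v 0 (codiag_val e) = face_h p.+1 (codiag_val e')
}.

Section CodiagGroup.
Variable n : nat.
Implicit Types x y z : codiag_type n.

Lemma codiag_eq x y : (forall p q (e : p + q = n), x p q e = y p q e) -> x = y.
Proof.
case: x => x xP; case: y => y yP /= xy.
have e : x = y.
  apply: functional_extensionality_dep => p.
  apply: functional_extensionality_dep => q.
  exact: functional_extensionality_dep.
by subst y; congr CodiagElt; apply: Prop_irrelevance.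
Qed.

Definition codiag_one : codiag_type n.
Proof. by exists (fun p q _ => 1) => p q e e'; rewrite !gmulf1. Defined.
Definition codiag_inv x : codiag_type n.
Proof.
exists (fun p q e => (x p q e)^-1) => p q e e'.
by rewrite !gmulfV (codiag_valP x e e').
Defined.
Definition codiag_mul x y : codiag_type n.
Proof.
exists (fun p q e => x p q e * y p q e) => p q e e'.
by rewrite !gmulfM (codiag_valP x e e') (codiag_valP y e e').
Defined.

Fact codiag_mulA : associative codiag_mul.
Proof. by move=> x y z; apply: codiag_eq => p q e; rewrite /= mulgA. Qed.
Fact codiag_mul1g : left_id codiag_one codiag_mul.
Proof. by move=> x; apply: codiag_eq => p q e; rewrite /= mul1g. Qed.
Fact codiag_mulg1 : right_id codiag_one codiag_mul.
Proof. by move=> x; apply: codiag_eq => p q e; rewrite /= mulg1. Qed.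
Fact codiag_mulVg : left_inverse codiag_one codiag_inv codiag_mul.
Proof. by move=> x; apply: codiag_eq => p q e; rewrite /= mulVg. Qed.
Fact codiag_mulgV : right_inverse codiag_one codiag_inv codiag_mul.
Proof. by move=> x; apply: codiag_eq => p q e; rewrite /= mulgV. Qed.

HB.instance Definition _ := gen_eqMixin (codiag_type n).
HB.instance Definition _ := gen_choiceMixin (codiag_type n).
HB.instance Definition _ := isGroup.Build (codiag_type n)
  codiag_mulA codiag_mul1g codiag_mulg1 codiag_mulVg codiag_mulgV.
End CodiagGroup.

Lemma codiag_irr n (x : codiag_type n) p q (e e' : p + q = n) :
  x p q e = x p q e'.
Proof. by rewrite (eq_irrelevance e e'). Qed.

Fact codiag_idx_v n p q : p + q = n -> p + q.+1 = n.+1.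
Proof. by move=> <-; rewrite addnS. Qed.
Fact codiag_idx_h n p q : p + q = n -> p.+1 + q = n.+1.
Proof. by move=> <-. Qed.
Fact codiag_idx_vK n p q : p + q.+1 = n.+1 -> p + q = n.
Proof. by rewrite addnS => -[]. Qed.
Fact codiag_idx_hK n p q : p.+1 + q = n.+1 -> p + q = n.
Proof. by rewrite addSn => -[]. Qed.

Definition codiag_face_val n (j : nat) (x : codiag_type n.+1)
    p q (e : p + q = n) : Y q p :=
  if p < j then face_v (j - p) (x p q.+1 (codiag_idx_v e))
  else face_h j (x p.+1 q (codiag_idx_h e)).

(* The two branches returning 1 are never reached when i <= n. *)
Definition codiag_degen_val n (i : nat) (x : codiag_type n)
    p q : p + q = n.+1 -> Y q p :=
  if p <= i then
    match q return p + q = n.+1 -> Y q p with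
    | 0 => fun _ => 1
    | q'.+1 => fun e => degen_v (i - p) (x p q' (codiag_idx_vK e))
    end
  else
    match p return p + q = n.+1 -> Y q p with
    | 0 => fun _ => 1
    | p'.+1 => fun e => degen_h i (x p' q (codiag_idx_hK e))
    end.

Fact codiag_face_valP n (j : nat) (x : codiag_type n.+1) : j <= n.+1 ->
  forall p q (e : p + q.+1 = n) (e' : p.+1 + q = n),
    face_v 0 (codiag_face_val j x e) = face_h p.+1 (codiag_face_val j x e').
Proof.
move=> jn p q e e'; rewrite /codiag_face_val.
have c1 := codiag_valP x (codiag_idx_v e) (codiag_idx_v e').
have c2 := codiag_valP x (codiag_idx_h e) (codiag_idx_h e').
rewrite (codiag_irr x (codiag_idx_v e') (codiag_idx_h e)) in c1 *.
case: (ltngtP p.+1 j) => [pj|jp|pj].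
- rewrite face_vv; [|lia|lia].
  rewrite (_ : (j - p).-1 = j - p.+1)%N; last lia.
  by rewrite c1 face_vh.
- by rewrite face_vh c2 [LHS]face_hh //; lia.
- have -> : (j - p = 1)%N by lia.
  rewrite [LHS](face_vv _ (isT : 0 < 1)) // c1 face_vh c2.
  by rewrite -pj [LHS]face_hh //; lia.
Qed.

Fact codiag_degen_valP n (i : nat) (x : codiag_type n) : i <= n ->
  forall p q (e : p + q.+1 = n.+1) (e' : p.+1 + q = n.+1),
    face_v 0 (codiag_degen_val i x e) = face_h p.+1 (codiag_degen_val i x e').
Proof.
move=> iN p q e e'; rewrite /codiag_degen_val.
case: (ltngtP p i) => [pi|ip|pi].
- case: q e e' => [|q] e e'; first lia.
  rewrite face_degen_v_lt; [|lia|lia].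
  rewrite (codiag_valP x _ (codiag_idx_vK e')) degen_v_face_h.
  by congr (face_h _ (degen_v _ _)); lia.
- case: p e e' ip => [|p] e e' ip; first lia.
  rewrite face_v_degen_h face_degen_h_gt; [|lia|lia].
  by rewrite (codiag_valP x _ (codiag_idx_hK e')).
- subst i; rewrite subnn face_degen_v_eq // face_degen_h_eq ?eqxx ?orbT //.
  exact: codiag_irr.
Qed.

Definition codiag_face_elt n (j : nat) (jn : j <= n.+1) (x : codiag_type n.+1) :
    codiag_type n :=
  CodiagElt (codiag_face_valP x jn).
Definition codiag_degen_elt n (i : nat) (iN : i <= n) (x : codiag_type n) :
    codiag_type n.+1 :=
  CodiagElt (codiag_degen_valP x iN).

Fact codiag_face_eltM n j (jn : j <= n.+1) :
  {morph codiag_face_elt jn : x y / x * y}.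
Proof.
move=> x y; apply: codiag_eq => p q e /=; rewrite /codiag_face_val.
by case: ifP => _; rewrite gmulfM.
Qed.
Fact codiag_degen_eltM n i (iN : i <= n) :
  {morph codiag_degen_elt iN : x y / x * y}.
Proof.
move=> x y; apply: codiag_eq => p q e /=; rewrite /codiag_degen_val.
case: ifP => _; first by case: q e => [|q] e; rewrite ?mulg1 ?gmulfM.
by case: p e => [|p] e; rewrite ?mulg1 ?gmulfM.
Qed.

Definition codiag_face n (j : 'I_n.+2) :
    ghom (codiag_type n.+1) (codiag_type n) :=
  mk_ghom (codiag_face_eltM (ltn_ord j : j <= n.+1)).
Definition codiag_degen n (i : 'I_n.+1) :
    ghom (codiag_type n) (codiag_type n.+1) :=
  mk_ghom (codiag_degen_eltM (ltn_ord i : i <= n)).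

Lemma codiag_faceE n j (x : codiag_type n.+1) p q (e : p + q = n) :
  j <= n.+1 -> codiag_face (inord j) x _ _ e = codiag_face_val j x e.
Proof. by move=> jn; rewrite /= inordK. Qed.
Lemma codiag_degenE n i (x : codiag_type n) p q (e : p + q = n.+1) :
  i <= n -> codiag_degen (inord i) x _ _ e = codiag_degen_val i x e.
Proof. by move=> iN; rewrite /= inordK. Qed.

Lemma codiag_face_v n j (x : codiag_type n.+1) p q (e : p + q = n)
    (e' : p + q.+1 = n.+1) : j <= n.+1 -> p < j ->
  codiag_face (inord j) x _ _ e = face_v (j - p) (x p q.+1 e').
Proof.
move=> jn pj; rewrite codiag_faceE // /codiag_face_val pj.
by rewrite (codiag_irr x e' (codiag_idx_v e)).
Qed.
Lemma codiag_face_h n j (x : codiag_type n.+1) p q (e : p + q = n)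
    (e' : p.+1 + q = n.+1) : j <= n.+1 -> j <= p ->
  codiag_face (inord j) x _ _ e = face_h j (x p.+1 q e').
Proof.
move=> jn jp; rewrite codiag_faceE // /codiag_face_val ltnNge jp.
by rewrite (codiag_irr x e' (codiag_idx_h e)).
Qed.
Lemma codiag_degen_v n i (x : codiag_type n) p q (e : p + q.+1 = n.+1)
    (e' : p + q = n) : i <= n -> p <= i ->
  codiag_degen (inord i) x _ _ e = degen_v (i - p) (x p q e').
Proof.
move=> iN pi; rewrite codiag_degenE // /codiag_degen_val pi.
by rewrite (codiag_irr x e' (codiag_idx_vK e)).
Qed.
Lemma codiag_degen_h n i (x : codiag_type n) p q (e : p.+1 + q = n.+1)
    (e' : p + q = n) : i <= n -> i <= p ->
  codiag_degen (inord i) x _ _ e = degen_h i (x p q e').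
Proof.
move=> iN pi; rewrite codiag_degenE // /codiag_degen_val ltnNge pi.
by rewrite (codiag_irr x e' (codiag_idx_hK e)).
Qed.

Definition codiag_ob : sobject GrpC.
Proof.
exists (fun n => codiag_type n : GrpC) codiag_face codiag_degen => n i j.
- move=> ij jn; apply: ghomP => x; apply: codiag_eq => p q e.
  rewrite -[LHS]/(codiag_face (inord i) (codiag_face (inord j) x) p q e).
  rewrite -[RHS]/(codiag_face (inord j.-1) (codiag_face (inord i) x) p q e).
  have e1 := codiag_idx_v e; have e2 := codiag_idx_h e.
  have e11 := codiag_idx_v e1; have e12 := codiag_idx_h e1.
  have e22 := codiag_idx_h e2.
  case: (ltnP p i) => pi.
    rewrite (codiag_face_v _ _ e1) 1?(codiag_face_v _ _ e11); try lia.
    rewrite [RHS](codiag_face_v _ _ e1) 1?(codiag_face_v _ _ e11); try lia.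
    rewrite face_vv; [|lia|lia].
    by congr (face_v _ _); lia.
  rewrite (codiag_face_h _ _ e2); try lia.
  case: (ltnP p.+1 j) => pj.
    rewrite (codiag_face_v _ _ e12); try lia.
    rewrite (codiag_face_v _ _ e1) 1?(codiag_face_h _ _ e12); try lia.
    rewrite -face_vh.
    by congr (face_v _ _); lia.
  rewrite (codiag_face_h _ _ e22); try lia.
  rewrite [RHS](codiag_face_h _ _ e2) 1?(codiag_face_h _ _ e22); try lia.
  by rewrite face_hh //; lia.
- move=> ij jn; apply: ghomP => x; apply: codiag_eq => p q e.
  rewrite -[LHS]/(codiag_face (inord i) (codiag_degen (inord j) x) p q e).
  rewrite -[RHS]/(codiag_degen (inord j.-1) (codiag_face (inord i) x) p q e).
  have e1 := codiag_idx_v e; have e2 := codiag_idx_h e.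
  case: (ltnP p i) => pi.
    rewrite (codiag_face_v _ _ e1); try lia.
    case: q e e1 e2 => [|q] e e1 e2; first lia.
    rewrite (codiag_degen_v _ _ e); try lia.
    have e0 := codiag_idx_vK e.
    rewrite (codiag_degen_v _ _ e0) 1?(codiag_face_v _ _ e); try lia.
    rewrite face_degen_v_lt; [|lia|lia].
    by congr (degen_v _ _); lia.
  rewrite (codiag_face_h _ _ e2); try lia.
  case: (ltnP p j.-1) => pj.
    case: q e e1 e2 => [|q] e e1 e2; first lia.
    have e0 := codiag_idx_vK e; have e3 := codiag_idx_vK e2.
    rewrite (codiag_degen_v _ _ e3); try lia.
    rewrite (codiag_degen_v _ _ e0) 1?(codiag_face_h _ _ e3); try lia.
    rewrite degen_v_face_h.
    by congr (face_h _ (degen_v _ _)); lia.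
  case: (ltnP j p.+1) => pj'.
    rewrite (codiag_degen_h _ _ e); try lia.
    case: p e e1 e2 pi pj pj' => [|p] e e1 e2 pi pj pj'; first lia.
    have e0 := codiag_idx_hK e.
    rewrite (codiag_degen_h _ _ e0) 1?(codiag_face_h _ _ e); try lia.
    by rewrite face_degen_h_lt //; lia.
  case: q e e1 e2 => [|q] e e1 e2; first lia.
  have e0 := codiag_idx_vK e; have e3 := codiag_idx_vK e2.
  rewrite (codiag_degen_v _ _ e3); try lia.
  rewrite (codiag_degen_v _ _ e0) 1?(codiag_face_h _ _ e3); try lia.
  rewrite degen_v_face_h.
  by congr (face_h _ (degen_v _ _)); lia.
- move=> jn ij; apply: ghomP => x; apply: codiag_eq => p q e.
  rewrite -[LHS]/(codiag_face (inord i) (codiag_degen (inord j) x) p q e).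
  have e1 := codiag_idx_v e; have e2 := codiag_idx_h e.
  case: (ltnP p i) => pi.
    rewrite (codiag_face_v _ _ e1) 1?(codiag_degen_v _ _ e); try lia.
    by rewrite face_degen_v_eq //; lia.
  rewrite (codiag_face_h _ _ e2) 1?(codiag_degen_h _ _ e); try lia.
  by rewrite face_degen_h_eq //; lia.
- move=> ji iN; apply: ghomP => x; apply: codiag_eq => p q e.
  rewrite -[LHS]/(codiag_face (inord i) (codiag_degen (inord j) x) p q e).
  rewrite -[RHS]/(codiag_degen (inord j) (codiag_face (inord i.-1) x) p q e).
  have e1 := codiag_idx_v e; have e2 := codiag_idx_h e.
  case: (leqP p j) => pj.
    rewrite (codiag_face_v _ _ e1) 1?(codiag_degen_v _ _ e); try lia.
    case: q e e1 e2 => [|q] e e1 e2; first lia.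
    have e0 := codiag_idx_vK e.
    rewrite (codiag_degen_v _ _ e0) 1?(codiag_face_v _ _ e); try lia.
    rewrite face_degen_v_gt; [|lia|lia].
    by congr (degen_v _ (face_v _ _)); lia.
  case: p e e1 e2 pj => [|p] e e1 e2 pj; first lia.
  have e0 := codiag_idx_hK e; have e3 := codiag_idx_hK e1.
  case: (ltnP p.+1 i) => pi.
    rewrite (codiag_face_v _ _ e1) 1?(codiag_degen_h _ _ e3); try lia.
    rewrite (codiag_degen_h _ _ e0) 1?(codiag_face_v _ _ e3); try lia.
    rewrite face_v_degen_h.
    by congr (degen_h _ (face_v _ _)); lia.
  rewrite (codiag_face_h _ _ e2) 1?(codiag_degen_h _ _ e); try lia.
  rewrite (codiag_degen_h _ _ e0) 1?(codiag_face_h _ _ e); try lia.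
  by rewrite face_degen_h_gt //; lia.
- move=> ij jn; apply: ghomP => x; apply: codiag_eq => p q e.
  rewrite -[LHS]/(codiag_degen (inord i) (codiag_degen (inord j) x) p q e).
  rewrite -[RHS]/(codiag_degen (inord j.+1) (codiag_degen (inord i) x) p q e).
  case: (leqP p i) => pi.
    case: q e => [|[|q]] e; try lia.
    have e0 := codiag_idx_vK e; have e1 := codiag_idx_vK e0.
    rewrite (codiag_degen_v _ _ e0) 1?(codiag_degen_v _ _ e1); try lia.
    rewrite [RHS](codiag_degen_v _ _ e0) 1?(codiag_degen_v _ _ e1); try lia.
    rewrite degen_vv; [|lia|lia].
    by congr (degen_v _ _); lia.
  case: p e pi => [|p] e pi; first lia.
  have e0 := codiag_idx_hK e.
  rewrite (codiag_degen_h _ _ e0); try lia.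
  case: (leqP p j) => pj.
    case: q e e0 => [|q] e e0; first lia.
    have e1 := codiag_idx_vK e; have e2 := codiag_idx_vK e0.
    rewrite (codiag_degen_v _ _ e2); try lia.
    rewrite (codiag_degen_v _ _ e1) 1?(codiag_degen_h _ _ e2); try lia.
    rewrite degen_vh.
    by congr (degen_h _ (degen_v _ _)); lia.
  case: p e e0 pi pj => [|p] e e0 pi pj; first lia.
  have e1 := codiag_idx_hK e0.
  rewrite (codiag_degen_h _ _ e1); try lia.
  rewrite (codiag_degen_h _ _ e0) 1?(codiag_degen_h _ _ e1); try lia.
  by rewrite degen_hh //; lia.
Defined.
End Codiagonal.
Arguments face_h {Y p q} i.
Arguments degen_h {Y p q} i.
Arguments face_v {Y p q} j.
Arguments degen_v {Y p q} j.

Section CodiagonalFunctor.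
Variables (Y Z : simpC (simpC GrpC)) (f : hom Y Z).

Definition bicomp p q : ghom (Y q p) (Z q p) := smor_at ((f : smor Y Z) q) p.

Lemma bicomp_h p q i (x : Y q p.+1) :
  bicomp p q (face_h i x) = face_h i (bicomp p.+1 q x).
Proof.
by have /(congr1 (fun g : ghom _ _ => g x)) :=
  smc_face ((f : smor Y Z) q : smor (Y q) (Z q)) (inord i : 'I_p.+2).
Qed.
Lemma bicomp_degen_h p q i (x : Y q p) :
  bicomp p.+1 q (degen_h i x) = degen_h i (bicomp p q x).
Proof.
by have /(congr1 (fun g : ghom _ _ => g x)) :=
  smc_degen ((f : smor Y Z) q : smor (Y q) (Z q)) (inord i : 'I_p.+1).
Qed.
Lemma bicomp_v p q j (x : Y q.+1 p) :
  bicomp p q (face_v j x) = face_v j (bicomp p q.+1 x).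
Proof.
by have /(congr1 (fun g : hom (Y q.+1) (Z q) => smor_at g p x)) :=
  smc_face (f : smor Y Z) (inord j : 'I_q.+2).
Qed.
Lemma bicomp_degen_v p q j (x : Y q p) :
  bicomp p q.+1 (degen_v j x) = degen_v j (bicomp p q x).
Proof.
by have /(congr1 (fun g : hom (Y q) (Z q.+1) => smor_at g p x)) :=
  smc_degen (f : smor Y Z) (inord j : 'I_q.+1).
Qed.

Definition codiag_map_elt n (x : codiag_type Y n) : codiag_type Z n.
Proof.
exists (fun p q e => bicomp p q (x p q e)) => p q e e'.
by rewrite -bicomp_v (codiag_valP x e e') bicomp_h.
Defined.

Fact codiag_map_eltM n : {morph @codiag_map_elt n : x y / x * y}.
Proof. by move=> x y; apply: codiag_eq => p q e; rewrite /= gmulfM. Qed.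

Definition codiag_map : smor (codiag_ob Y) (codiag_ob Z).
Proof.
exists (fun n => mk_ghom (@codiag_map_eltM n) : @hom GrpC _ _) => n i.
- apply: ghomP => x; apply: codiag_eq => p q e /=; rewrite /codiag_face_val.
  by case: ifP => _; rewrite ?bicomp_v ?bicomp_h.
- apply: ghomP => x; apply: codiag_eq => p q e /=; rewrite /codiag_degen_val.
  case: ifP => _; first by case: q e => [|q] e; rewrite ?gmulf1 ?bicomp_degen_v.
  by case: p e => [|p] e; rewrite ?gmulf1 ?bicomp_degen_h.
Defined.
End CodiagonalFunctor.

Fact codiag_map1 (Y : simpC (simpC GrpC)) :
  codiag_map (idm Y) = idm (codiag_ob Y : simpC GrpC).
Proof.
by apply: smorP => n; apply: ghomP => x; apply: codiag_eq.
Qed.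
Fact codiag_mapM (X Y Z : simpC (simpC GrpC)) (g : hom Y Z) (f : hom X Y) :
  codiag_map (g \oc f) =
  (codiag_map g : hom (codiag_ob Y : simpC GrpC) (codiag_ob Z)) \oc codiag_map f.
Proof.
by apply: smorP => n; apply: ghomP => x; apply: codiag_eq.
Qed.

Definition codiagonal : functor (simpC (simpC GrpC)) (simpC GrpC) :=
  @Functor (simpC (simpC GrpC)) (simpC GrpC) codiag_ob codiag_map
    codiag_map1 codiag_mapM.

(* [mcodiagonal m] is the (m+1)-fold codiagonal; it is defined on
   (m+1)-simplicial groups, the 1-fold one being the identity. *)
Fixpoint mcodiagonal (m : nat) : functor (msimpC m.+1) (simpC GrpC) :=
  if m is m'.+1 then functor_comp codiagonal (simpF (mcodiagonal m'))
  else functor_id (simpC GrpC).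

Definition cat1_axiom (G : groupType) (s t : ghom G G) : Prop :=
  [/\ forall x, s (t x) = t x, forall x, t (s x) = s x &
      forall x y, s x = 1 -> t y = 1 -> x * y * x^-1 * y^-1 = 1].

Record cat1group := Cat1Group {
  c1_group :> groupType;
  c1_s : ghom c1_group c1_group;
  c1_t : ghom c1_group c1_group;
  c1_axiom : cat1_axiom c1_s c1_t
}.
Arguments c1_s {c}.
Arguments c1_t {c}.

Record catgroup (m : nat) := CatGroup {
  cg_group :> groupType;
  cg_s : 'I_m -> ghom cg_group cg_group;
  cg_t : 'I_m -> ghom cg_group cg_group;
  cg_axiom : forall i, cat1_axiom (cg_s i) (cg_t i);
  cg_ss : forall i j, i != j -> forall x, cg_s i (cg_s j x) = cg_s j (cg_s i x);
  cg_tt : forall i j, i != j -> forall x, cg_t i (cg_t j x) = cg_t j (cg_t i x);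
  cg_st : forall i j, i != j -> forall x, cg_s i (cg_t j x) = cg_t j (cg_s i x)
}.
Arguments cg_s {m c} i.
Arguments cg_t {m c} i.

Definition catgroup_dir (m : nat) (G : catgroup m) (i : 'I_m) : cat1group :=
  Cat1Group (cg_axiom G i).

Record catgroup_hom (m : nat) (G H : catgroup m) := CatGroupHom {
  cgh :> ghom G H;
  cgh_s : forall i x, cgh (cg_s i x) = cg_s i (cgh x);
  cgh_t : forall i x, cgh (cg_t i x) = cg_t i (cgh x)
}.

Lemma catgroup_homP m (G H : catgroup m) (f g : catgroup_hom G H) :
  f =1 g -> f = g.
Proof.
case: f => f f1 f2; case: g => g g1 g2 /= /ghomP e.
by subst g; rewrite (Prop_irrelevance f1 g1) (Prop_irrelevance f2 g2).
Qed.

Lemma catgroup_hom_eq m (G H : catgroup m) (f g : catgroup_hom G H) :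
  cgh f = cgh g -> f = g.
Proof. by move=> fg; apply: catgroup_homP => x; rewrite fg. Qed.

Section CatGroupCategory.
Variable m : nat.
Definition cgid (G : catgroup m) : catgroup_hom G G.
Proof. by exists (gid G). Defined.
Definition cgcomp (G H K : catgroup m) (g : catgroup_hom H K)
  (f : catgroup_hom G H) : catgroup_hom G K.
Proof. by exists (gcomp g f) => i x; rewrite /= ?cgh_s ?cgh_t. Defined.
Fact cgcmp1m (G H : catgroup m) (f : catgroup_hom G H) : cgcomp (cgid H) f = f.
Proof. exact: catgroup_homP. Qed.
Fact cgcmpm1 (G H : catgroup m) (f : catgroup_hom G H) : cgcomp f (cgid G) = f.
Proof. exact: catgroup_homP. Qed.
Fact cgcmpA (G H K L : catgroup m) (h : catgroup_hom K L)
  (g : catgroup_hom H K) (f : catgroup_hom G H) :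
  cgcomp h (cgcomp g f) = cgcomp (cgcomp h g) f.
Proof. exact: catgroup_homP. Qed.
Definition CatGrpC : category := Category cgcmp1m cgcmpm1 cgcmpA.
End CatGroupCategory.

Section Nerve.
Variable G : cat1group.
Local Notation s := (@c1_s G).
Local Notation t := (@c1_t G).

Lemma c1_st x : s (t x) = t x. Proof. by case: (c1_axiom G). Qed.
Lemma c1_ts x : t (s x) = s x. Proof. by case: (c1_axiom G). Qed.
Lemma c1_ss x : s (s x) = s x. Proof. by rewrite -{1}(c1_ts x) c1_st c1_ts. Qed.
Lemma c1_tt x : t (t x) = t x. Proof. by rewrite -{1}(c1_st x) c1_ts c1_st. Qed.
Lemma c1_comm x y : s x = 1 -> t y = 1 -> x * y = y * x.
Proof.
case: (c1_axiom G) => _ _ H sx ty; have /(congr1 (fun z => z * (y * x))) := H x y sx ty.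
by rewrite mul1g !mulgA mulgVK mulgVK.
Qed.

(* [c1_cmp g' g] is the composite of g followed by g'. *)
Definition c1_cmp (g' g : G) : G := g' * (s g')^-1 * g.

Lemma c1_cmp_s g' g : t g = s g' -> s (c1_cmp g' g) = s g.
Proof. by move=> e; rewrite /c1_cmp !gmulfM gmulfV c1_ss mulgV mul1g. Qed.
Lemma c1_cmp_t g' g : t g = s g' -> t (c1_cmp g' g) = t g'.
Proof. by move=> e; rewrite /c1_cmp !gmulfM gmulfV c1_ts e mulgVK. Qed.
Lemma c1_cmpA g'' g' g : t g' = s g'' -> 
  c1_cmp g'' (c1_cmp g' g) = c1_cmp (c1_cmp g'' g') g.
Proof.
move=> e; rewrite {3}/c1_cmp c1_cmp_s // /c1_cmp.
by rewrite !mulgA.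
Qed.
Lemma c1_cmpM g1' g1 g2' g2 : t g1 = s g1' -> t g2 = s g2' ->
  c1_cmp (g1' * g2') (g1 * g2) = c1_cmp g1' g1 * c1_cmp g2' g2.
Proof.
move=> e1 e2; rewrite /c1_cmp gmulfM invgM !mulgA; congr (_ * _).
rewrite -!mulgA; congr (_ * _); rewrite !mulgA -(mulgA _ _ g1) -[RHS]mulgA.
apply: c1_comm; first by rewrite gmulfM gmulfV c1_ss mulgV.
by rewrite gmulfM gmulfV c1_ts e1 mulVg.
Qed.

Definition c1_objects : subgroup G.
Proof.
exists (fun x : G => exists y, x = s y).
- by exists 1; rewrite gmulf1.
- by move=> _ _ [x ->] [y ->]; exists (x * y); rewrite gmulfM.
- by move=> _ [x ->]; exists x^-1; rewrite gmulfV.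
Defined.

(* The composable strings (g_1,...,g_{n+1}), with g_{k+1} written [g k]. *)
Definition c1_strings (n : nat) : subgroup {ffun 'I_n.+1 -> G}.
Proof.
exists (fun g : {ffun 'I_n.+1 -> G} =>
  forall k, k < n -> t (g (inord k)) = s (g (inord k.+1))).
- by move=> k kn; rewrite !ffunE !gmulf1.
- by move=> g h Hg Hh k kn; rewrite !ffunE !gmulfM Hg ?Hh.
- by move=> g Hg k kn; rewrite !ffunE !gmulfV Hg.
Defined.

Definition nerve_ob (n : nat) : groupType :=
  if n is n'.+1 then c1_strings n' else c1_objects.

Definition face0_val (i : nat) (g : {ffun 'I_1 -> G}) : G :=
  if i == 0 then t (g ord0) else s (g ord0).

Definition faceS_val (n i : nat) (g : {ffun 'I_n.+2 -> G}) :
    {ffun 'I_n.+1 -> G} :=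
  [ffun k : 'I_n.+1 =>
    if k.+1 < i then g (inord k)
    else if k.+1 == i then c1_cmp (g (inord k.+1)) (g (inord k))
    else g (inord k.+1)].

(* The [i]-th vertex of a string, 0 <= i <= n+1. *)
Definition string_vtx (n i : nat) (g : {ffun 'I_n.+1 -> G}) : G :=
  if i <= n then s (g (inord i)) else t (g ord_max).

Definition degen0_val (x : G) : {ffun 'I_1 -> G} := [ffun=> x].

Definition degenS_val (n i : nat) (g : {ffun 'I_n.+1 -> G}) :
    {ffun 'I_n.+2 -> G} :=
  [ffun k : 'I_n.+2 =>
    if k < i then g (inord k)
    else if k == i :> nat then string_vtx i g
    else g (inord k.-1)].

Fact face0_subproof i (g : c1_strings 0) : c1_objects (face0_val i (sgval g)).
Proof.
rewrite /face0_val; case: ifP => _; last by exists (sgval g ord0).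
by exists (t (sgval g ord0)); rewrite c1_st.
Qed.

Fact faceS_subproof n i (g : c1_strings n.+1) :
  c1_strings n (faceS_val i (sgval g)).
Proof.
case: g => g Hg k kn /=; rewrite !ffunE !inordK; [|lia|lia].
have H0 := Hg k (leqW kn); have H1 := Hg k.+1 kn.
case: (ltngtP k.+2 i) => ki.
- exact: H0.
- by case: ifP => _; rewrite ?c1_cmp_t.
- by rewrite c1_cmp_s.
Qed.

Fact degen0_subproof (x : c1_objects) : c1_strings 0 (degen0_val (sgval x)).
Proof. by []. Qed.

Lemma string_vtx_s n (g : c1_strings n) k : k <= n ->
  s (sgval g (inord k)) = string_vtx k (sgval g).
Proof. by move=> kn; rewrite /string_vtx kn. Qed.

Lemma string_vtx_t n (g : c1_strings n) k : k <= n ->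
  t (sgval g (inord k)) = string_vtx k.+1 (sgval g).
Proof.
move=> kn; rewrite /string_vtx; case: (ltnP k n) => kn'.
  exact: (sgvalP g) kn'.
by congr (t (sgval g _)); apply: val_inj; rewrite /= inordK //; lia.
Qed.

Lemma s_string_vtx n k (g : {ffun 'I_n.+1 -> G}) :
  s (string_vtx k g) = string_vtx k g.
Proof. by rewrite /string_vtx; case: ifP => _; rewrite ?c1_ss ?c1_st. Qed.

Lemma t_string_vtx n k (g : {ffun 'I_n.+1 -> G}) :
  t (string_vtx k g) = string_vtx k g.
Proof. by rewrite /string_vtx; case: ifP => _; rewrite ?c1_ts ?c1_tt. Qed.

Fact degenS_subproof n i (g : c1_strings n) : i <= n.+1 ->
  c1_strings n.+1 (degenS_val i (sgval g)).
Proof.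
move=> iN k kn /=; rewrite !ffunE !inordK; [|lia|lia].
case: (ltngtP k i) => ki.
- case: (ltngtP k.+1 i) => ki'; last 1 first.
  + by rewrite string_vtx_t // s_string_vtx ki'.
  + by apply: (sgvalP g); lia.
  + lia.
- rewrite ifF; last lia.
  rewrite ifF; last lia.
  case: k kn ki => // k kn ki /=.
  exact: (sgvalP g).
- rewrite ifF; last lia.
  rewrite ifF; last lia.
  by rewrite t_string_vtx /= string_vtx_s // ki.
Qed.

Fact face0_valM i (g h : c1_strings 0) :
  face0_val i (sgval (g * h)) = face0_val i (sgval g) * face0_val i (sgval h).
Proof. by rewrite /face0_val; case: ifP => _; rewrite ffunE gmulfM. Qed.

Fact faceS_valM n i (g h : c1_strings n.+1) :
  faceS_val i (sgval (g * h)) = faceS_val i (sgval g) * faceS_val i (sgval h).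
Proof.
apply/ffunP => k; rewrite !ffunE.
have kn : k < n.+1 := ltn_ord k.
case: ifP => // _; case: ifP => // _.
by rewrite c1_cmpM //; [apply: (sgvalP g)|apply: (sgvalP h)].
Qed.

Fact string_vtxM n i (g h : {ffun 'I_n.+1 -> G}) :
  string_vtx i (g * h) = string_vtx i g * string_vtx i h.
Proof. by rewrite /string_vtx; case: ifP => _; rewrite ffunE gmulfM. Qed.

Fact degenS_valM n i (g h : {ffun 'I_n.+1 -> G}) :
  degenS_val i (g * h) = degenS_val i g * degenS_val i h.
Proof.
apply/ffunP => k; rewrite !ffunE.
by case: ifP => // _; case: ifP => // _; rewrite string_vtxM.
Qed.

Definition nerve_face_elt (n i : nat) : nerve_ob n.+1 -> nerve_ob n :=
  match n return nerve_ob n.+1 -> nerve_ob n with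
  | 0 => fun g => SgElt (face0_subproof i g)
  | n'.+1 => fun g => SgElt (faceS_subproof i g)
  end.

Definition nerve_degen_elt (n i : nat) : i <= n -> nerve_ob n -> nerve_ob n.+1 :=
  match n return i <= n -> nerve_ob n -> nerve_ob n.+1 with
  | 0 => fun _ x => SgElt (degen0_subproof x)
  | n'.+1 => fun iN g => SgElt (degenS_subproof g iN)
  end.

Fact nerve_face_eltM n i : {morph @nerve_face_elt n i : x y / x * y}.
Proof.
case: n => [|n] x y; apply: sgval_inj; first exact: face0_valM.
exact: faceS_valM.
Qed.

Fact nerve_degen_eltM n i (iN : i <= n) :
  {morph nerve_degen_elt iN : x y / x * y}.
Proof.
case: n iN => [|n] iN x y; apply: sgval_inj; last exact: degenS_valM.
by apply/ffunP => k; rewrite !ffunE.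
Qed.

Definition nerve_face n (i : 'I_n.+2) : ghom (nerve_ob n.+1) (nerve_ob n) :=
  mk_ghom (@nerve_face_eltM n i).
Definition nerve_degen n (i : 'I_n.+1) : ghom (nerve_ob n) (nerve_ob n.+1) :=
  mk_ghom (nerve_degen_eltM (ltn_ord i : i <= n)).

Definition vtx n : nerve_ob n -> nat -> G :=
  match n return nerve_ob n -> nat -> G with
  | 0 => fun x _ => sgval x
  | n'.+1 => fun g k => string_vtx k (sgval g)
  end.
Definition arr n : nerve_ob n -> nat -> G :=
  match n return nerve_ob n -> nat -> G with
  | 0 => fun _ _ => 1
  | n'.+1 => fun g k => sgval g (inord k)
  end.

Lemma nerve_eq n (x y : nerve_ob n) :
  (forall k, k <= n -> vtx x k = vtx y k) ->
  (forall k, k < n -> arr x k = arr y k) -> x = y.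
Proof.
case: n x y => [|n] x y Hv Ha; apply: sgval_inj; first exact: Hv 0%N isT.
apply/ffunP => k; have := Ha k (ltn_ord k).
by rewrite /= inord_val.
Qed.

Lemma vtxM n (x y : nerve_ob n) k : vtx (x * y) k = vtx x k * vtx y k.
Proof. by case: n x y => [|n] x y //=; rewrite string_vtxM. Qed.
Lemma arrM n (x y : nerve_ob n) k : arr (x * y) k = arr x k * arr y k.
Proof. by case: n x y => [|n] x y /=; rewrite ?mulg1 // ffunE. Qed.

Definition vtx_hom n k : ghom (nerve_ob n) G :=
  mk_ghom (fun x y => @vtxM n x y k).
Definition arr_hom n k : ghom (nerve_ob n) G :=
  mk_ghom (fun x y => @arrM n x y k).

Lemma arr_s n (x : nerve_ob n) k : k < n -> s (arr x k) = vtx x k.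
Proof. by case: n x => // n x kn; apply: string_vtx_s. Qed.
Lemma arr_t n (x : nerve_ob n) k : k < n -> t (arr x k) = vtx x k.+1.
Proof. by case: n x => // n x kn; apply: string_vtx_t. Qed.
Lemma vtx_s n (x : nerve_ob n) k : s (vtx x k) = vtx x k.
Proof.
case: n x => [|n] x /=; last exact: s_string_vtx.
by have [y ->] := sgvalP x; rewrite c1_ss.
Qed.
Lemma vtx_t n (x : nerve_ob n) k : t (vtx x k) = vtx x k.
Proof. by rewrite -[in LHS]vtx_s c1_ts vtx_s. Qed.

Lemma c1_cmp_vtx_l n (x : nerve_ob n) k :
  c1_cmp (vtx x k.+1) (arr x k) = arr x k.
Proof. by rewrite /c1_cmp vtx_s mulgV mul1g. Qed.
Lemma c1_cmp_vtx_r n (x : nerve_ob n) k : k < n ->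
  c1_cmp (arr x k) (vtx x k) = arr x k.
Proof. by move=> kn; rewrite /c1_cmp arr_s // mulgVK. Qed.

Lemma arr_face n i k (x : nerve_ob n.+1) : i <= n.+1 -> k < n ->
  arr (nerve_face (inord i) x) k =
    if k.+1 < i then arr x k
    else if k.+1 == i then c1_cmp (arr x k.+1) (arr x k)
    else arr x k.+1.
Proof. by case: n x => // n x iN kn; rewrite /= ffunE !inordK. Qed.

Lemma vtx_face n i k (x : nerve_ob n.+1) : i <= n.+1 -> k <= n ->
  vtx (nerve_face (inord i) x) k = vtx x (if k < i then k else k.+1).
Proof.
case: n x => [|n] x iN kn.
  move: kn; rewrite leqn0 => /eqP ->.
  rewrite /= /face0_val inordK // lt0n; case: eqP => _ /=.
    rewrite -string_vtx_t //; congr (t (sgval x _)).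
    by apply: val_inj; rewrite /= inordK.
  rewrite -string_vtx_s //; congr (s (sgval x _)).
  by apply: val_inj; rewrite /= inordK.
have arrE := arr_face x iN.
case: (ltnP k n.+1) => kn'.
  rewrite -arr_s // arrE //.
  case: (ltngtP k.+1 i) => ki; rewrite ?c1_cmp_s ?arr_s ?arr_t //; lia.
have -> : k = n.+1 by lia.
rewrite -arr_t // arrE //.
case: (ltngtP n.+1 i) => ki; rewrite ?c1_cmp_t ?arr_s ?arr_t //; lia.
Qed.

Lemma arr_degen n i k (x : nerve_ob n) : i <= n -> k <= n ->
  arr (nerve_degen (inord i) x) k =
    if k < i then arr x k
    else if k == i then vtx x i
    else arr x k.-1.
Proof.
case: n x => [|n] x iN kn; last by rewrite /= ffunE !inordK.
by rewrite /= ffunE; case: k i kn iN => [|k] [|i].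
Qed.

Lemma vtx_degen n i k (x : nerve_ob n) : i <= n -> k <= n.+1 ->
  vtx (nerve_degen (inord i) x) k = vtx x (if k <= i then k else k.-1).
Proof.
move=> iN kn; have arrE := arr_degen x iN.
case: (leqP k n) => kn'.
  rewrite -arr_s // arrE //.
  case: (ltngtP k i) => ki; rewrite ?vtx_s ?ki ?arr_s //; lia.
have -> : k = n.+1 by lia.
rewrite -arr_t // arrE // ltnNge iN /=.
case: eqP => ni; first by rewrite vtx_t; congr (vtx x _).
rewrite arr_t; last lia.
by congr (vtx x _); lia.
Qed.

Local Ltac split_ifs :=
  repeat match goal with
  | |- context [if ?b then _ else _] =>
    lazymatch b with
    | context [if _ then _ else _] => fail
    | _ => case: (boolP b) => ?
    end
  end.
Local Ltac nerve_tac x :=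
  split_ifs; try (by []); try (exfalso; lia); try (congr (arr x _); lia);
  try (congr (vtx x _); lia); try (congr (c1_cmp (arr x _) (arr x _)); lia).
Local Ltac nerve_arr x :=
  split_ifs; try (exfalso; lia);
  rewrite ?arr_face ?arr_degen ?vtx_face ?vtx_degen; try lia; nerve_tac x.

Definition nerve_sob : sobject GrpC.
Proof.
exists (fun n => nerve_ob n : GrpC) nerve_face nerve_degen => n i j.
- move=> ij jn; apply: ghomP => x.
  rewrite -[LHS]/(nerve_face (inord i) (nerve_face (inord j) x)).
  rewrite -[RHS]/(nerve_face (inord j.-1) (nerve_face (inord i) x)).
  apply: nerve_eq => k kn.
    rewrite !vtx_face; try by (split_ifs; lia).
    by nerve_tac x.
  rewrite !arr_face; try lia.
  nerve_tac x.
  by rewrite c1_cmpA // arr_t ?arr_s //; lia.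
- move=> ij jn; apply: ghomP => x.
  rewrite -[LHS]/(nerve_face (inord i) (nerve_degen (inord j) x)).
  rewrite -[RHS]/(nerve_degen (inord j.-1) (nerve_face (inord i) x)).
  apply: nerve_eq => k kn.
    rewrite vtx_face ?vtx_degen ?vtx_face; try by (split_ifs; lia).
    by nerve_tac x.
  rewrite arr_face ?arr_degen; try lia.
  nerve_arr x.
- move=> jn ij; apply: ghomP => x.
  rewrite -[LHS]/(nerve_face (inord i) (nerve_degen (inord j) x)) -[RHS]/x.
  apply: nerve_eq => k kn.
    rewrite vtx_face ?vtx_degen; try by (split_ifs; lia).
    by nerve_tac x.
  rewrite arr_face ?arr_degen; try lia.
  nerve_tac x.
  + rewrite (_ : j = k.+1) ?c1_cmp_vtx_l //; lia.
  + rewrite (_ : j = k) ?c1_cmp_vtx_r //; lia.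
- move=> ji iN; apply: ghomP => x.
  rewrite -[LHS]/(nerve_face (inord i) (nerve_degen (inord j) x)).
  rewrite -[RHS]/(nerve_degen (inord j) (nerve_face (inord i.-1) x)).
  apply: nerve_eq => k kn.
    rewrite vtx_face ?vtx_degen ?vtx_face; try by (split_ifs; lia).
    by nerve_tac x.
  rewrite arr_face ?arr_degen; try lia.
  nerve_arr x.
- move=> ij jn; apply: ghomP => x.
  rewrite -[LHS]/(nerve_degen (inord i) (nerve_degen (inord j) x)).
  rewrite -[RHS]/(nerve_degen (inord j.+1) (nerve_degen (inord i) x)).
  apply: nerve_eq => k kn.
    rewrite !vtx_degen; try by (split_ifs; lia).
    by nerve_tac x.
  rewrite arr_degen; try lia.
  rewrite [RHS]arr_degen; try lia.
  rewrite !vtx_degen; try lia.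
  nerve_arr x.
Defined.
End Nerve.

Record cat1hom (G H : cat1group) := Cat1Hom {
  c1h :> ghom G H;
  c1h_s : forall x, c1h (c1_s x) = c1_s (c1h x);
  c1h_t : forall x, c1h (c1_t x) = c1_t (c1h x)
}.

Section NerveMap.
Variables (G H : cat1group) (f : cat1hom G H).

Fact nerve_map0_subproof (x : c1_objects G) : c1_objects H (f (sgval x)).
Proof. by have [y ->] := sgvalP x; exists (f y); rewrite c1h_s. Qed.
Fact nerve_mapS_subproof n (g : c1_strings G n) :
  c1_strings H n [ffun k => f (sgval g k)].
Proof. by move=> k kn; rewrite !ffunE -c1h_t -c1h_s (sgvalP g). Qed.

Definition nerve_map_elt n : nerve_ob G n -> nerve_ob H n :=
  match n return nerve_ob G n -> nerve_ob H n with
  | 0 => fun x => SgElt (nerve_map0_subproof x)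
  | n'.+1 => fun g => SgElt (nerve_mapS_subproof g)
  end.

Fact nerve_map_eltM n : {morph @nerve_map_elt n : x y / x * y}.
Proof.
case: n => [|n] x y; apply: sgval_inj; first exact: gmulfM.
by apply/ffunP => k; rewrite !ffunE gmulfM.
Qed.

Definition nerve_map n : ghom (nerve_ob G n) (nerve_ob H n) :=
  mk_ghom (@nerve_map_eltM n).

Lemma vtx_map n (x : nerve_ob G n) k : vtx (nerve_map n x) k = f (vtx x k).
Proof.
case: n x => [|n] x //=; rewrite /string_vtx.
by case: ifP => _; rewrite ffunE ?c1h_s ?c1h_t.
Qed.
Lemma arr_map n (x : nerve_ob G n) k : arr (nerve_map n x) k = f (arr x k).
Proof. by case: n x => [|n] x /=; rewrite ?gmulf1 ?ffunE. Qed.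

Lemma c1_cmp_map g' g : f (c1_cmp g' g) = c1_cmp (f g') (f g).
Proof. by rewrite /c1_cmp !gmulfM gmulfV c1h_s. Qed.

Lemma nerve_map_face n (i : 'I_n.+2) (x : nerve_ob G n.+1) :
  nerve_map n (nerve_face G i x) = nerve_face H i (nerve_map n.+1 x).
Proof.
have iN : i <= n.+1 by rewrite -ltnS.
rewrite -(inord_val i); apply: nerve_eq => k kn.
  by rewrite vtx_map !vtx_face // vtx_map.
rewrite arr_map !arr_face // !arr_map.
by case: ifP => // _; case: ifP => // _; rewrite c1_cmp_map.
Qed.
Lemma nerve_map_degen n (i : 'I_n.+1) (x : nerve_ob G n) :
  nerve_map n.+1 (nerve_degen G i x) = nerve_degen H i (nerve_map n x).
Proof.
have iN : i <= n by rewrite -ltnS.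
rewrite -(inord_val i); apply: nerve_eq => k kn.
  by rewrite vtx_map !vtx_degen // vtx_map.
rewrite arr_map !arr_degen // !arr_map vtx_map.
by case: ifP => // _; case: ifP => // _.
Qed.
End NerveMap.

(* The nerve is taken in the last of the m+1 directions, so that after
   iteration the k-th index of the m-fold nerve comes from the k-th
   cat^1-structure. *)
Section CatNerve.
Variables (m : nat) (G : catgroup m.+1).
Local Notation last := (ord_max : 'I_m.+1).
Local Notation lft := (lift (ord_max : 'I_m.+1)).

Definition cat_nerve_group n : groupType := nerve_ob (catgroup_dir G last) n.

Definition dir_s (i : 'I_m) :
  cat1hom (catgroup_dir G last) (catgroup_dir G last).
Proof.
exists (cg_s (lft i)) => x /=; first by rewrite cg_ss // eq_sym neq_lift.
by rewrite cg_st // eq_sym neq_lift.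
Defined.
Definition dir_t (i : 'I_m) :
  cat1hom (catgroup_dir G last) (catgroup_dir G last).
Proof.
exists (cg_t (lft i)) => x /=; first by rewrite cg_st // neq_lift.
by rewrite cg_tt // eq_sym neq_lift.
Defined.

Definition cat_nerve_ob (n : nat) : catgroup m.
Proof.
exists (cat_nerve_group n) (fun i => nerve_map (dir_s i) n)
  (fun i => nerve_map (dir_t i) n).
- move=> i; have [st ts co] := cg_axiom G (lft i); split.
  + move=> x; apply: nerve_eq => k _; rewrite ?vtx_map ?arr_map; exact: st.
  + move=> x; apply: nerve_eq => k _; rewrite ?vtx_map ?arr_map; exact: ts.
  + move=> x y sx ty; apply: nerve_eq => k _.
      rewrite -![vtx _ k]/(vtx_hom _ n k _) !gmulfM !gmulfV gmulf1.
      by apply: co; rewrite -[LHS](vtx_map (dir_s i), vtx_map (dir_t i))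
           ?sx ?ty -[LHS]/(vtx_hom _ n k _) gmulf1.
    rewrite -![arr _ k]/(arr_hom _ n k _) !gmulfM !gmulfV gmulf1.
    by apply: co; rewrite -[LHS](arr_map (dir_s i), arr_map (dir_t i))
         ?sx ?ty -[LHS]/(arr_hom _ n k _) gmulf1.
- move=> i j ij x; apply: nerve_eq => k _; rewrite ?vtx_map ?arr_map /=;
    exact/cg_ss/(contra_neq _ ij)/lift_inj.
- move=> i j ij x; apply: nerve_eq => k _; rewrite ?vtx_map ?arr_map /=;
    exact/cg_tt/(contra_neq _ ij)/lift_inj.
- move=> i j ij x; apply: nerve_eq => k _; rewrite ?vtx_map ?arr_map /=;
    exact/cg_st/(contra_neq _ ij)/lift_inj.
Defined.

Definition cat_nerve_face n (i : 'I_n.+2) :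
  catgroup_hom (cat_nerve_ob n.+1) (cat_nerve_ob n).
Proof.
by exists (nerve_face (catgroup_dir G last) i) => k x;
  exact/esym/nerve_map_face.
Defined.
Definition cat_nerve_degen n (i : 'I_n.+1) :
  catgroup_hom (cat_nerve_ob n) (cat_nerve_ob n.+1).
Proof.
by exists (nerve_degen (catgroup_dir G last) i) => k x;
  exact/esym/nerve_map_degen.
Defined.

Definition cat_nerve : sobject (CatGrpC m).
Proof.
exists (fun n => cat_nerve_ob n : CatGrpC m) cat_nerve_face cat_nerve_degen
  => n i j.
- by move=> ij jn; apply: catgroup_hom_eq; exact: (sface_face (nerve_sob _) ij jn).
- by move=> ij jn; apply: catgroup_hom_eq; exact: (sface_degen_lt (nerve_sob _) ij jn).
- by move=> jn ij; apply: catgroup_hom_eq; exact: (sface_degen_eq (nerve_sob _) jn ij).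
- by move=> ji iN; apply: catgroup_hom_eq; exact: (sface_degen_gt (nerve_sob _) ji iN).
- by move=> ij jn; apply: catgroup_hom_eq; exact: (sdegen_degen (nerve_sob _) ij jn).
Defined.
End CatNerve.

Section CatNerveMap.
Variables (m : nat) (G H : catgroup m.+1) (f : catgroup_hom G H).

Definition dir_hom :
  cat1hom (catgroup_dir G ord_max) (catgroup_dir H ord_max).
Proof. by exists (cgh f) => x; [apply: cgh_s|apply: cgh_t]. Defined.

Definition cat_nerve_map_at n :
  catgroup_hom (cat_nerve_ob G n) (cat_nerve_ob H n).
Proof.
exists (nerve_map dir_hom n) => i x; apply: nerve_eq => k _;
  rewrite /= ?vtx_map ?arr_map /= ?vtx_map ?arr_map; by [apply: cgh_s|apply: cgh_t].
Defined.

Definition cat_nerve_map : smor (cat_nerve G) (cat_nerve H).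
Proof.
exists (fun n => cat_nerve_map_at n : @hom (CatGrpC m) _ _) => n i;
  apply: catgroup_homP => x; [exact: nerve_map_face|exact: nerve_map_degen].
Defined.
End CatNerveMap.

Fact cat_nerve_map1 m (G : CatGrpC m.+1) :
  cat_nerve_map (idm G) = idm (cat_nerve G : simpC (CatGrpC m)).
Proof.
apply: smorP => n; apply: catgroup_homP => x; apply: nerve_eq => k _.
  exact: (vtx_map (dir_hom (idm G))).
exact: (arr_map (dir_hom (idm G))).
Qed.
Fact cat_nerve_mapM m (G H K : CatGrpC m.+1) (g : hom H K) (f : hom G H) :
  cat_nerve_map (g \oc f) =
  (cat_nerve_map g : hom (cat_nerve H : simpC (CatGrpC m)) (cat_nerve K)) \oc
  cat_nerve_map f.
Proof.
apply: smorP => n; apply: catgroup_homP => x; apply: nerve_eq => k _.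
  rewrite [LHS](vtx_map (dir_hom (g \oc f))).
  by rewrite [RHS](vtx_map (dir_hom g)) (vtx_map (dir_hom f)).
rewrite [LHS](arr_map (dir_hom (g \oc f))).
by rewrite [RHS](arr_map (dir_hom g)) (arr_map (dir_hom f)).
Qed.

Definition cat_nerveF (m : nat) : functor (CatGrpC m.+1) (simpC (CatGrpC m)) :=
  @Functor (CatGrpC m.+1) (simpC (CatGrpC m)) (@cat_nerve m)
    (@cat_nerve_map m) (@cat_nerve_map1 m) (@cat_nerve_mapM m).

Definition forgetF : functor (CatGrpC 0) GrpC :=
  @Functor (CatGrpC 0) GrpC (fun G : catgroup 0 => cg_group G)
    (fun G H f => cgh f) (fun G => erefl) (fun G H K g f => erefl).

Fixpoint mnerve (m : nat) : functor (CatGrpC m) (msimpC m) :=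
  if m is m'.+1 then functor_comp (simpF (mnerve m')) (cat_nerveF m')
  else forgetF.

Section CrossedCubeAxioms.
Variables (m : nat) (M : {set 'I_m} -> groupType).
Variable mu : forall (i : 'I_m) (A : {set 'I_m}), ghom (M A) (M (A :\ i)).
Variable h : forall A B : {set 'I_m}, M A -> M B -> M (A :|: B).
Implicit Types (A B C : {set 'I_m}) (i j : 'I_m).

(* Elements of M_A and M_B are compared when A = B holds only
   propositionally. *)
Definition cc_eq A B (a : M A) (b : M B) : Prop := Tagged M a = Tagged M b.
Local Notation "a =~ b" := (cc_eq a b) (at level 70).

Definition cc_cast A B (e : A = B) (a : M A) : M B := ecast X (M X) e a.

(* The action ^a b = h(a,b) b of M_A on M_B, for A included in B. *)
Definition cc_act A B (sAB : A \subset B) (a : M A) (b : M B) : M B :=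
  cc_cast (elimT setUidPr sAB) (h a b) * b.

Record crossed_cube_axioms : Prop := CrossedCubeAxioms {
  cc_mu_id : forall i A (a : M A), i \notin A -> mu i A a =~ a;
  cc_mu_mu : forall i j A (a : M A),
    mu i _ (mu j A a) =~ mu j _ (mu i A a);
  cc_mu_h : forall i A B (a : M A) (b : M B),
    mu i _ (h a b) =~ h (mu i A a) (mu i B b);
  cc_h_mul : forall i A B (a : M A) (b : M B),
    i \in A :&: B -> h a b =~ h (mu i A a) b;
  cc_h_mur : forall i A B (a : M A) (b : M B),
    i \in A :&: B -> h a b =~ h a (mu i B b);
  cc_h_comm : forall A (a a' : M A), h a a' =~ a * a' * a^-1 * a'^-1;
  cc_h_inv : forall A B (a : M A) (b : M B), h a b =~ (h b a)^-1;
  cc_h1g : forall A B (b : M B), h (1 : M A) b = 1;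
  cc_hg1 : forall A B (a : M A), h a (1 : M B) = 1;
  cc_hMl : forall A B (a a' : M A) (b : M B),
    h (a * a') b = cc_act (subsetUl A B) a (h a' b) * h a b;
  cc_hMr : forall A B (a : M A) (b b' : M B),
    h a (b * b') = h a b * cc_act (subsetUr A B) b (h a b');
  cc_act_h : forall A B C (sB : A \subset B) (sC : A \subset C)
      (sBC : A \subset B :|: C) (a : M A) (b : M B) (c : M C),
    cc_act sBC a (h b c) = h (cc_act sB a b) (cc_act sC a c);
  cc_hall_witt : forall A B C
      (sA : A \subset A :|: B :|: C) (sC : C \subset C :|: A :|: B)
      (sB : B \subset B :|: C :|: A)
      (eC : C :|: A :|: B = A :|: B :|: C) (eB : B :|: C :|: A = A :|: B :|: C)
      (a : M A) (b : M B) (c : M C),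
    cc_act sA a (h (h a^-1 b) c) *
    cc_cast eC (cc_act sC c (h (h c^-1 a) b)) *
    cc_cast eB (cc_act sB b (h (h b^-1 c) a)) = 1
}.
End CrossedCubeAxioms.

Record crossed_cube (m : nat) := CrossedCube {
  cc_grp :> {set 'I_m} -> groupType;
  cc_mu : forall i A, ghom (cc_grp A) (cc_grp (A :\ i));
  cc_h : forall A B, cc_grp A -> cc_grp B -> cc_grp (A :|: B);
  cc_axioms : crossed_cube_axioms cc_mu cc_h
}.
Arguments cc_mu {m} c i {A}.
Arguments cc_h {m} c {A B} _ _ : rename.

Record crossed_cube_hom (m : nat) (M N : crossed_cube m) := CrossedCubeHom {
  cch :> forall A, ghom (M A) (N A);
  cch_mu : forall i A (a : M A), cch (A :\ i) (cc_mu M i a) = cc_mu N i (cch A a);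
  cch_h : forall A B (a : M A) (b : M B),
    cch (A :|: B) (cc_h M a b) = cc_h N (cch A a) (cch B b)
}.

Lemma crossed_cube_homP m (M N : crossed_cube m) (f g : crossed_cube_hom M N) :
  (forall A, f A =1 g A) -> f = g.
Proof.
case: f => f f1 f2; case: g => g g1 g2 /= fg.
have e := functional_extensionality_dep (fun A => ghomP (fg A)).
by subst g; rewrite (Prop_irrelevance f1 g1) (Prop_irrelevance f2 g2).
Qed.

Section CrossedCubeCategory.
Variable m : nat.
Definition ccid (M : crossed_cube m) : crossed_cube_hom M M.
Proof. by exists (fun A => gid (M A)). Defined.
Definition cccomp (M N P : crossed_cube m) (g : crossed_cube_hom N P)
  (f : crossed_cube_hom M N) : crossed_cube_hom M P.
Proof.
exists (fun A => gcomp (g A) (f A)); first by move=> i A a; rewrite /= !cch_mu.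
by move=> A B a b; rewrite /= !cch_h.
Defined.
Fact cccmp1m (M N : crossed_cube m) (f : crossed_cube_hom M N) :
  cccomp (ccid N) f = f.
Proof. exact: crossed_cube_homP. Qed.
Fact cccmpm1 (M N : crossed_cube m) (f : crossed_cube_hom M N) :
  cccomp f (ccid M) = f.
Proof. exact: crossed_cube_homP. Qed.
Fact cccmpA (M N P Q : crossed_cube m) (h : crossed_cube_hom P Q)
  (g : crossed_cube_hom N P) (f : crossed_cube_hom M N) :
  cccomp h (cccomp g f) = cccomp (cccomp h g) f.
Proof. exact: crossed_cube_homP. Qed.
Definition CrossedCubeC : category := Category cccmp1m cccmpm1 cccmpA.
End CrossedCubeCategory.

Section CrossedCubeOf.
Variables (m : nat) (G : catgroup m).
Implicit Types (A B C : {set 'I_m}) (i j : 'I_m).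

Definition cco_sub A : subgroup G.
Proof.
exists (fun x : G => (forall i, i \in A -> cg_s i x = 1) /\
                     (forall i, i \notin A -> exists y, x = cg_s i y)).
- split=> [i _|i _]; first by rewrite gmulf1.
  by exists 1; rewrite gmulf1.
- move=> x y [Kx Ix] [Ky Iy]; split=> i iA; first by rewrite gmulfM Kx ?Ky ?mulg1.
  by have [u ->] := Ix i iA; have [v ->] := Iy i iA; exists (u * v); rewrite gmulfM.
- move=> x [Kx Ix]; split=> i iA; first by rewrite gmulfV Kx ?invg1.
  by have [u ->] := Ix i iA; exists u^-1; rewrite gmulfV.
Defined.

Lemma cg_s_t i (x : G) : cg_s i (cg_t i x) = cg_t i x.
Proof. by have [] := cg_axiom G i. Qed.
Lemma cg_t_s i (x : G) : cg_t i (cg_s i x) = cg_s i x.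
Proof. by have [] := cg_axiom G i. Qed.

Fact cco_mu_subproof i A (a : cco_sub A) : cco_sub (A :\ i) (cg_t i (sgval a)).
Proof.
have [K I] := sgvalP a; split=> j.
  by rewrite !inE => /andP[ji jA]; rewrite cg_st // K // gmulf1.
rewrite !inE negb_and negbK; have [-> _|ji /= jA] := eqVneq j i.
  by exists (cg_t i (sgval a)); rewrite cg_s_t.
by have [y ->] := I j jA; exists (cg_t i y); rewrite cg_st.
Qed.

Definition cco_mu_elt i A (a : cco_sub A) : cco_sub (A :\ i) :=
  SgElt (cco_mu_subproof i a).
Fact cco_mu_eltM i A : {morph @cco_mu_elt i A : x y / x * y}.
Proof. by move=> x y; apply: sgval_inj; exact: gmulfM. Qed.
Definition cco_mu i A : ghom (cco_sub A) (cco_sub (A :\ i)) :=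
  mk_ghom (@cco_mu_eltM i A).

Fact cco_h_subproof A B (a : cco_sub A) (b : cco_sub B) :
  cco_sub (A :|: B)
    (sgval a * sgval b * (sgval a)^-1 * (sgval b)^-1).
Proof.
have [Ka Ia] := sgvalP a; have [Kb Ib] := sgvalP b; split=> i; rewrite !inE.
  rewrite !gmulfM !gmulfV; case/orP => H; rewrite ?(Ka i H) ?(Kb i H) invg1.
    by rewrite mul1g mulg1 mulgV.
  by rewrite !mulg1 mulgV.
rewrite negb_or => /andP[iA iB].
have [x ->] := Ia i iA; have [y ->] := Ib i iB.
by exists (x * y * x^-1 * y^-1); rewrite !gmulfM !gmulfV.
Qed.

Definition cco_h A B (a : cco_sub A) (b : cco_sub B) : cco_sub (A :|: B) :=
  SgElt (cco_h_subproof a b).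

Lemma cco_eq A B (a : cco_sub A) (b : cco_sub B) :
  A = B -> sgval a = sgval b -> Tagged cco_sub a = Tagged cco_sub b.
Proof. by move=> e; subst B => /sgval_inj ->. Qed.

Local Notation castM := (@cc_cast m cco_sub).
Lemma cco_cast A B (e : A = B) (a : cco_sub A) : sgval (castM e a) = sgval a.
Proof. by subst B. Qed.

Lemma cco_act A B (sAB : A \subset B) (a : cco_sub A) (b : cco_sub B) :
  sgval (@cc_act m cco_sub cco_h A B sAB a b) = sgval a * sgval b * (sgval a)^-1.
Proof. by rewrite /cc_act /= cco_cast /= mulgVK. Qed.

Lemma cco_comm_l i (x y : G) : cg_s i y = 1 ->
  x * y * x^-1 * y^-1 = cg_t i x * y * (cg_t i x)^-1 * y^-1.
Proof.
move=> sy; have [st ts co] := cg_axiom G i.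
set u := cg_t i x; have tu : cg_t i u = u by rewrite /u -{1}(st x) ts st.
have k1 : cg_t i (u^-1 * x) = 1 by rewrite gmulfM gmulfV tu mulVg.
have /(congr1 (fun z => z * y)) := divg1_eq (co y (u^-1 * x) sy k1).
rewrite mulgVK; have : x = u * (u^-1 * x) by rewrite mulVKg.
move: (u^-1 * x) => k -> e.
by rewrite invgM !mulgA -(mulgA u k y) -e !mulgA mulgK.
Qed.

Definition gsimp (K : groupType) :=
  (@invgM K, @invgK K, @mulgA K, @mulgVK K, @mulgK K, @mulVg K, @mulgV K,
   @mul1g K, @mulg1 K, @invg1 K).

Fact cco_axioms : crossed_cube_axioms cco_mu cco_h.
Proof.
split.
- move=> i A a iA; apply: cco_eq.
    by apply/setP => j; rewrite !inE; case: eqVneq => // ->; rewrite (negPf iA).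
  by have [_ I] := sgvalP a; have [y /= ->] := I i iA; rewrite cg_t_s.
- move=> i j A a; apply: cco_eq; first by rewrite !setDDl setUC.
  by have [->|ij] := eqVneq i j; rewrite //= cg_tt.
- move=> i A B a b; apply: cco_eq; first exact: setDUl.
  by rewrite /= !gmulfM !gmulfV.
- move=> i A B a b /setIP[iA iB]; apply: cco_eq.
    by apply/setP => j; rewrite !inE; case: eqVneq => // ->; rewrite iB orbT.
  by have [K _] := sgvalP b; apply: cco_comm_l; apply: K.
- move=> i A B a b /setIP[iA iB]; apply: cco_eq.
    by apply/setP => j; rewrite !inE; case: eqVneq => // ->; rewrite iA.
  have [K _] := sgvalP a; have /(congr1 inv) := cco_comm_l (sgval b) (K i iA).
  by rewrite !gsimp.
- by move=> A a a'; apply: cco_eq; first exact: setUid.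
- move=> A B a b; apply: cco_eq; first exact: setUC.
  by rewrite /= !gsimp.
- by move=> A B b; apply: sgval_inj; rewrite /= !gsimp.
- by move=> A B a; apply: sgval_inj; rewrite /= !gsimp.
- by move=> A B a a' b; apply: sgval_inj; rewrite /= !cco_cast /= !gsimp.
- by move=> A B a b b'; apply: sgval_inj; rewrite /= !cco_cast /= !gsimp.
- move=> A B C sB sC sBC a b c; apply: sgval_inj.
  by rewrite /= !cco_cast /= !gsimp.
- move=> A B C sA sC sB eC eB a b c; apply: sgval_inj.
  by rewrite /= !cco_cast /= !cco_cast /= !gsimp.
Qed.

Definition crossed_cube_of : crossed_cube m := CrossedCube cco_axioms.
End CrossedCubeOf.

(* X is an m-fold nerve of M: it is isomorphic to the m-fold nerve of a
   cat^m-group whose associated crossed m-cube is isomorphic to M.  Such an X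
   is unique up to isomorphism. *)
Definition is_mnerve (m : nat) (M : crossed_cube m) (X : msimpC m) : Prop :=
  exists G : catgroup m,
    @isomorphic (CrossedCubeC m) (crossed_cube_of G) M /\
    isomorphic (mnerve m G) X.

(* Main.v *)
Require Import Defs.
From mathcomp Require Import all_boot.
From mathcomp Require Import zify.

(** Say that a simplicial group has Moore length at most [d] if its Moore
    complex is trivial above degree [d].  The proof is an induction on the
    number of directions, resting on two facts.

    Moore lengths add up under the codiagonal ([codiagonal_moore_length]).  Let
    x = (x_0,...,x_n) be killed by d_0,...,d_{n-1}.  Reading off the components
    of these faces, x_p is killed by the horizontal d_0,...,d_{p-1} and by the
    vertical d_1,...,d_{n-p-1}; the one vertical face missing from a Moore
    condition is controlled by the compatibility d_0^v x_p = d_{p+1}^h x_{p+1}.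
    So, descending from p = n, each x_p is 1: for p large because rows have
    trivial Moore complex in degree p, and for p small because columns have
    trivial Moore complex in degree n - p and x_{p+1} = 1.

    The columns have Moore length at most 1 ([column_moore_length]).  The
    columns of the bisimplicial group to which the last codiagonal is applied
    are obtained from the nerve in the last direction, a simplicial
    cat^m-group, by applying degreewise the functor taking a cat^m-group to the
    group of p-simplices of the codiagonal of its m-fold nerve.  In degree at
    least 2 the faces d_0 and d_1 of a nerve are jointly injective: d_0 returns
    all arrows but the first, and d_1 the composite of the first two, from
    which the first is recovered because arrows are invertible.  Joint
    injectivity survives the functor, since nerves and codiagonals are groups
    of families on which morphisms act entry by entry
    ([mcodiagonal_mnerve_joint_injectivity]).

    The statement for any m-fold nerve of the crossed cube follows because the
    bound on the Moore length is invariant under isomorphism. *)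

Set Implicit Arguments.
Unset Strict Implicit.
Unset Printing Implicit Defensive.

Local Open Scope group_scope.

Definition moore_length_le (d : nat) (X : simpC GrpC) : Prop :=
  forall n, d < n -> trivial_group (moore X n).

Lemma moore_length_leP d (X : simpC GrpC) :
  moore_length_le d X <->
  forall n (x : X n.+1), d <= n -> (forall i, i <= n -> face i x = 1) -> x = 1.
Proof.
split=> [X1 n x dn dx | X1 [//|n] dn [x dx]].
  exact: (congr1 (@sgval _ _) (X1 n.+1 dn (SgElt (dx : moore X n.+1 x)))).
by apply: sgval_inj; apply: X1.
Qed.

(** The inverse maps the Moore complex of [Y] into that of [X], which is
    trivial, and it is injective. *)
Lemma moore_length_le_iso d (X Y : simpC GrpC) :
  isomorphic X Y -> moore_length_le d X -> moore_length_le d Y.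
Proof.
move=> [f [g [_ fg]]] /moore_length_leP X1; apply/moore_length_leP => n y dn dy.
have gy1 : (g : smor _ _) n.+1 y = 1 :> X n.+1.
  apply: X1 => // i iN.
  have /(congr1 (fun h : ghom _ _ => h y)) :=
    smc_face (g : smor Y X) (inord i : 'I_n.+2).
  move=> /= <-.
  by have := congr1 (smor_at g n) (dy i iN); rewrite gmulf1.
have /(congr1 (fun h : smor Y Y => (h n.+1 : ghom _ _) y)) /= := fg.
by rewrite gy1 gmulf1 => <-.
Qed.

Lemma isomorphic_functor (C D : category) (F : functor C D) (a b : C) :
  isomorphic a b -> isomorphic (F a) (F b).
Proof.
move=> [f [g [gf fg]]]; exists (fmap F f), (fmap F g).
by rewrite -!fmapM gf fg !fmap1.
Qed.

Lemma functor_compE (C D E : category) (F : functor D E) (G : functor C D)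
  (a : C) : functor_comp F G a = F (G a).
Proof. by []. Qed.

(** * Moore length of a codiagonal *)

Fact simplices_M (p : nat) (X Y Z : simpC GrpC) (g : hom Y Z) (f : hom X Y) :
  smor_at (g \oc f) p = (smor_at g p : @hom GrpC _ _) \oc smor_at f p.
Proof. by []. Qed.
Definition simplices (p : nat) : functor (simpC GrpC) GrpC :=
  @Functor (simpC GrpC) GrpC (fun X => X p) (fun X Y f => smor_at f p)
    (fun X => erefl) (@simplices_M p).

Definition column (Y : simpC (simpC GrpC)) (p : nat) : simpC GrpC :=
  simpF (simplices p) Y.

(** Each index (p, q) of total degree above [a + b] has p > [a] or q > [b], so
    each component is in the range of a row or a column bound; the column
    bound also needs d_0^v x_p = 1, whence the induction from p = n down. *)
Lemma codiagonal_moore_length (a b : nat) (Y : simpC (simpC GrpC)) :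
  (forall q, moore_length_le a (Y q)) ->
  (forall p, moore_length_le b (column Y p)) ->
  moore_length_le (a + b) (codiagonal Y).
Proof.
move=> rowY colY; apply/moore_length_leP => n x abn dx.
(* The component of index (p, q) of d_(p+j) x is d_j^v x_p as soon as j > 0. *)
have dxv p q (e : p + q.+1 = n.+1) j : 0 < j -> j <= q ->
    face_v j (x p q.+1 e) = 1.
  move=> j0 jq; have e' := codiag_idx_vK e.
  have pjn : p + j <= n by lia.
  have := congr1 (fun y : codiag_type Y n => y p q e') (dx _ pjn).
  rewrite -[face _ _]/(codiag_face Y (inord (p + j)) x).
  by rewrite (codiag_face_v _ _ e) ?addKn //; lia.
have dxh p q (e : p.+1 + q = n.+1) j : j <= p -> face_h j (x p.+1 q e) = 1.
  move=> jp; have e' := codiag_idx_hK e.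
  have jn : j <= n by lia.
  have := congr1 (fun y : codiag_type Y n => y p q e') (dx _ jn).
  rewrite -[face _ _]/(codiag_face Y (inord j) x).
  by rewrite (codiag_face_h _ _ e) //; lia.
have row1 p q (e : p + q = n.+1) : a < p -> x p q e = 1.
  case: p e => // p e ap.
  by have /moore_length_leP := rowY q; apply => // j; apply: dxh.
apply: codiag_eq => p q; elim: q p => [|q IHq] p e; first by apply: row1; lia.
have [ap|pa] := ltnP a p; first exact: row1.
have /moore_length_leP colp := colY p; apply: (colp q); first by lia.
move=> [_|j jq]; last exact: dxv.
(* The compatibility condition turns d_0^v x_p into a face of x_{p+1}. *)
have := codiag_valP x e (etrans (addSnnS p q) e).
by rewrite IHq gmulf1.
Qed.

(** * Jointly injective pairs of homomorphisms *)

Definition jointly_injective (G H1 H2 : groupType) (f1 : ghom G H1)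
    (f2 : ghom G H2) : Prop :=
  forall x, f1 x = 1 -> f2 x = 1 -> x = 1.

Lemma vtx1 (G : cat1group) (n k : nat) : vtx (1 : nerve_ob G n) k = 1.
Proof. exact: (gmulf1 (s := vtx_hom G n k)). Qed.

Lemma arr1 (G : cat1group) (n k : nat) : arr (1 : nerve_ob G n) k = 1.
Proof. exact: (gmulf1 (s := arr_hom G n k)). Qed.

Lemma nerve_map_jointly_injective (G H1 H2 : cat1group) (f1 : cat1hom G H1)
    (f2 : cat1hom G H2) (n : nat) :
  jointly_injective f1 f2 ->
  jointly_injective (nerve_map f1 n) (nerve_map f2 n).
Proof.
move=> inj12 x x1 x2.
apply: nerve_eq => k _; rewrite ?vtx1 ?arr1; apply: inj12.
- by rewrite -vtx_map x1 vtx1.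
- by rewrite -vtx_map x2 vtx1.
- by rewrite -arr_map x1 arr1.
- by rewrite -arr_map x2 arr1.
Qed.

(** In degree at least 2 every vertex but the first and every arrow but the
    first occur in d_0; the composite g_2 s(g_2)^-1 g_1 given by d_1 then
    forces g_1, hence its source. *)
Lemma nerve_face01_jointly_injective (G : cat1group) (n : nat) :
  jointly_injective (nerve_face G (inord 0 : 'I_n.+3))
                    (nerve_face G (inord 1 : 'I_n.+3)).
Proof.
move=> x x0 x1.
have arrS k : k < n.+1 -> arr x k.+1 = 1.
  by move=> kn; have := arr_face x (isT : 0 <= n.+2) kn; rewrite x0 arr1.
have arr0 : arr x 0 = 1.
  have := arr_face x (isT : 1 <= n.+2) (isT : 0 < n.+1).
  by rewrite x1 arr1 ltnn eqxx /c1_cmp arrS // gmulf1 invg1 !mul1g.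
have arrx k : k < n.+2 -> arr x k = 1 by case: k.
apply: nerve_eq => k kn; last by rewrite arrx ?arr1.
rewrite vtx1; case: k kn => [|k] kn; first by rewrite -arr_s // arr0 gmulf1.
by rewrite -arr_t // arrx // gmulf1.
Qed.

(** Elements of the codiagonal are families on which maps act entrywise. *)
Lemma codiag_map_jointly_injective (Y Z1 Z2 : simpC (simpC GrpC))
    (f1 : hom Y Z1) (f2 : hom Y Z2) (n : nat) :
  (forall p q, jointly_injective (bicomp f1 p q) (bicomp f2 p q)) ->
  jointly_injective (smor_at (codiag_map f1) n) (smor_at (codiag_map f2) n).
Proof.
move=> inj12 x x1 x2; apply: codiag_eq => p q e; apply: inj12.
  exact: (congr1 (fun y : codiag_type Z1 n => y p q e) x1).
exact: (congr1 (fun y : codiag_type Z2 n => y p q e) x2).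
Qed.

(** * Codiagonals of iterated nerves *)

Definition preserves_joint_injectivity (m : nat)
    (F : functor (CatGrpC m) (simpC GrpC)) : Prop :=
  forall (G H1 H2 : catgroup m) (f1 : catgroup_hom G H1)
    (f2 : catgroup_hom G H2) (p : nat),
  jointly_injective f1 f2 ->
  jointly_injective (smor_at (fmap F f1) p) (smor_at (fmap F f2) p).

(** For [N] the iterated nerve and [D] the iterated codiagonal of one order,
    [add_direction] is the iterated codiagonal of the iterated nerve of the
    next order. *)
Section AddDirection.
Variables (m : nat) (C : category).
Variables (N : functor (CatGrpC m) C) (D : functor C (simpC GrpC)).

Definition add_direction : functor (CatGrpC m.+1) (simpC GrpC) :=
  functor_comp (functor_comp codiagonal (simpF D))
    (functor_comp (simpF N) (cat_nerveF m)).

Lemma add_directionE (G : catgroup m.+1) :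
  add_direction G =
  codiagonal (simpF D (simpF N (cat_nerve G : simpC (CatGrpC m)))).
Proof. by rewrite /add_direction !functor_compE. Qed.

Lemma add_direction_joint_injectivity :
  preserves_joint_injectivity (functor_comp D N) ->
  preserves_joint_injectivity add_direction.
Proof.
move=> DN_inj G H1 H2 f1 f2 n inj12.
apply: (@codiag_map_jointly_injective
  (simpF D (simpF N (cat_nerve G : simpC _))) _ _
  (fmap (simpF D) (fmap (simpF N) (cat_nerve_map f1 : @hom (simpC _) _ _)))
  (fmap (simpF D) (fmap (simpF N) (cat_nerve_map f2 : @hom (simpC _) _ _))))
  => p q.
apply: (DN_inj _ _ _ (cat_nerve_map_at f1 q) (cat_nerve_map_at f2 q)).
exact: (@nerve_map_jointly_injective _ _ _ (dir_hom f1) (dir_hom f2)).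
Qed.

(** A column is D (N (nerve of [G])) at simplicial degree [p], so its faces are
    the images of the faces of the nerve, of which d_0 and d_1 already form a
    jointly injective pair. *)
Lemma column_moore_length (G : catgroup m.+1) (p : nat) :
  preserves_joint_injectivity (functor_comp D N) ->
  moore_length_le 1
    (column (simpF D (simpF N (cat_nerve G : simpC (CatGrpC m)))) p).
Proof.
move=> DN_inj.
apply/moore_length_leP => -[//|n] x _ dx.
apply: (DN_inj _ _ _ (cat_nerve_face G (inord 0 : 'I_n.+3))
                     (cat_nerve_face G (inord 1 : 'I_n.+3)) p).
- exact: nerve_face01_jointly_injective.
- exact: dx.
- exact: dx.
Qed.

Lemma add_direction_moore_length (d : nat) :
  preserves_joint_injectivity (functor_comp D N) ->
  (forall G : catgroup m, moore_length_le d (D (N G))) ->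
  forall G : catgroup m.+1, moore_length_le d.+1 (add_direction G).
Proof.
move=> DN_inj DN_d G; rewrite -[d.+1]addn1 add_directionE.
apply: codiagonal_moore_length => [q|p]; first exact: DN_d.
exact: column_moore_length.
Qed.
End AddDirection.

Definition mcodiagonal_mnerve (m : nat) : functor (CatGrpC m.+1) (simpC GrpC) :=
  functor_comp (mcodiagonal m) (mnerve m.+1).

Lemma mcodiagonal_mnerveS (m : nat) :
  mcodiagonal_mnerve m.+1 = add_direction (mnerve m.+1) (mcodiagonal m).
Proof. exact: erefl. Qed.

Lemma mcodiagonal_mnerve_joint_injectivity (m : nat) :
  preserves_joint_injectivity (mcodiagonal_mnerve m).
Proof.
elim: m => [|m IHm].
  move=> G H1 H2 f1 f2 p inj12.
  exact: (@nerve_map_jointly_injective _ _ _ (dir_hom f1) (dir_hom f2)).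
by rewrite mcodiagonal_mnerveS; apply: add_direction_joint_injectivity.
Qed.

Lemma mcodiagonal_mnerve_moore_length (m : nat) (G : catgroup m.+1) :
  moore_length_le m.+1 (mcodiagonal_mnerve m G).
Proof.
elim: m G => [|m IHm] G.
  apply/moore_length_leP => -[//|n] x _ dx.
  by apply: nerve_face01_jointly_injective; apply: dx.
rewrite mcodiagonal_mnerveS; apply: add_direction_moore_length => //.
exact: mcodiagonal_mnerve_joint_injectivity.
Qed.

(* The integer m >= 1 of the informal statement is m.+1 here. *)
Theorem theorem8p2 (m : nat) (M : crossed_cube m.+1) (X : msimpC m.+1)
    (hX : is_mnerve M X) (n : nat) (hn : m.+2 <= n) :
  trivial_group (moore (mcodiagonal m X) n).
Proof.
have [G [_ isoX]] := hX.
apply: (moore_length_le_iso (isomorphic_functor (mcodiagonal m) isoX)) hn.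
exact: mcodiagonal_mnerve_moore_length.
Qed.
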